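(* Let $q\ge2$, $c\ge1$, $\hat d\ge1$ be integers, let $z\in\{1,\dots,q-1\}$ with $\gcd(cq,z)=1$, and let $n=c\hat d q$. Let $B\in\mathcal M_n^0(cq,c\hat dq-z)$ and let $(\hat z_1,\dots,\hat z_{\hat d})\in\mathscr P_{II}(B)$ (Type II partition class with respect to the parameters $cq,\hat d$). For $i=1,\dots,\hat d$ define $\beta_i:=c-\langle\hat z_i\rangle_c$, $w_i:=(\hat z_i-\langle\hat z_i\rangle_c)/c$, and for $j=1,\dots,c$ let $z(i,j)=w_i$ if $j\le\beta_i$ and $z(i,j)=w_i+1$ if $\beta_i<j\le c$. Then the partition class $\mathscr P_{II}(B^c)$ (with respect to the parameters $q,c\hat d$) exists and consists of the parts $z(i,j)$, $i=1,\dots,\hat d$, $j=1,\dots,c$, where $z(i,j)$ is followed by $z(\langle i+1\rangle_{\hat d},\langle j-\beta_i\rangle_c)$.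
   Context: For an integer $k$ and $m\ge1$, $\langle k\rangle_m:=1+((k-1)\bmod m)\in\{1,\dots,m\}$. A matrix is stochastic if it is entrywise nonnegative with all row sums $1$. For a nonnegative $n\times n$ matrix $A$, $\Gamma(A)$ is the digraph on $\{1,\dots,n\}$ with an edge $(i,j)$ iff $a_{ij}\ne0$. For distinct vertices $v_1,\dots,v_k$, $C(v_1,\dots,v_k)$ is the directed cycle with edges $(v_i,v_{\langle i+1\rangle_k})$. Karpelevič arcs: $\Theta_n$ is the set of eigenvalues of all $n\times n$ stochastic matrices. For integers $a<b\le n$ with $\gcd(a,b)=1$, $a+b>n$, let $(p/a,r/b)$ be the unique Farey pair of order $n$ with denominators $a,b$ in this order, and let $\mathcal K_n(a,b)=\mathcal K_n(b,a)$ be the set of points of $\partial\Theta_n$ with argument in $(2\pi p/a,2\pi r/b)\cup(2\pi(b-r)/b,2\pi(a-p)/a)$. $\mathcal M_n(a,b)$ is the set of $n\times n$ stochastic matrices with an eigenvalue in $\mathcal K_n(a,b)$; $\mathcal M_n^0(a,b)$ is the set of $A\in\mathcal M_n(a,b)$ such that no $A'\in\mathcal M_n(a,b)$ has its set of nonzero positions strictly contained in that of $A$. Type II partition classes: for positive integers $Q,D$ and a sequence $\mathbf z=(z_1,\dots,z_D)$ of nonnegative integers with $\sum z_i\le Q-1$, let $\Gamma^{II}_{\mathbf z}$ be the digraph on $\{1,\dots,QD\}$ consisting of the cycles $C((i-1)Q+1,\dots,iQ)$, $i=1,\dots,D$, together with the edges $(iQ-z_i,\langle1+iQ\rangle_{QD})$,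 $i=1,\dots,D$. If $A$ is stochastic with $\Gamma(A)\cong\Gamma^{II}_{\mathbf z}$, its partition class $\mathscr P_{II}(A)$ (with respect to $Q,D$) is the set of cyclic rotations of $\mathbf z$ (it depends only on $A$). (Known: for $n=QD$, $D\ge2$, $1\le z\le Q-1$, $\gcd(Q,QD-z)=1$, every $A\in\mathcal M_n^0(Q,QD-z)$ is of this form with $\sum z_i=z$.) Phrase: given numbers $x_\iota$ indexed by a finite set $I$ of size $m$ and a map $\sigma:I\to I$, a partition class $\mathscr P$ ''consists of the parts $x_\iota$, where $x_\iota$ is followed by $x_{\sigma(\iota)}$'' means $\sigma$ is a single $m$-cycle on $I$ and $\mathscr P$ is the set of cyclic rotations of $(x_{\iota_0},x_{\sigma(\iota_0)},\dots,x_{\sigma^{m-1}(\iota_0)})$ for some $\iota_0\in I$. *)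

(* Defs.v *)
From HB Require Import structures.
From mathcomp Require Import all_boot all_order all_algebra.
From mathcomp Require Import complex.
From mathcomp Require Import all_classical all_reals all_analysis.

Set Implicit Arguments.
Unset Strict Implicit.
Unset Printing Implicit Defensive.

Import Order.TTheory GRing.Theory Num.Theory.
Import numFieldNormedType.Exports.

Local Open Scope classical_set_scope.
Local Open Scope ring_scope.
Local Open Scope complex_scope.

(* <k>_m; for m > 0 the remainder (_ %% m)%Z lies in {0, ..., m - 1}, so the
   absolute value only serves to land in nat *)
Definition angle_mod (k : int) (m : nat) : nat :=
  (1 + `|((k - 1) %% m)%Z|)%N.

Definition stochastic (R : realType) (n : nat) (A : 'M[R]_n) : Prop :=
  (forall i j, 0 <= A i j) /\ (forall i, \sum_j A i j = 1).

Definition digraph_mx (R : realType) (n : nat) (A : 'M[R]_n) : rel 'I_n :=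
  fun i j => A i j != 0.

Definition nonzero_positions (R : realType) (n : nat) (A : 'M[R]_n) :
  {set 'I_n * 'I_n} := [set ij | A ij.1 ij.2 != 0]%SET.

Definition digraph_iso (T T' : finType) (e : rel T) (e' : rel T') : Prop :=
  exists2 f : T -> T', bijective f & forall u v, e u v = e' (f u) (f v).

(* Edges of the directed cycle C(v_1, ..., v_k), for s = [:: v_1; ...; v_k]
   duplicate-free *)
Definition cycle_edge (s : seq nat) : rel nat :=
  fun u v => (u \in s) && (v == next s u).

Definition complex_eigenvalue (R : realType) (n : nat) (A : 'M[R]_n)
    (lambda : R[i]) : bool :=
  eigenvalue (map_mx (real_complex R) A) lambda.

Definition Theta (R : realType) (n : nat) : set R[i] :=
  [set lambda | exists2 A : 'M[R]_n, stochastic A & complex_eigenvalue A lambda].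

(* R[i]^o is R[i] with the topology of its norm *)
Definition boundary (R : realType) (S : set R[i]) : set R[i] :=
  closure (S : set R[i]^o) `\` interior (S : set R[i]^o).

Definition in_Farey (n : nat) (x : rat) : Prop :=
  0 <= x <= 1 /\ (denq x <= n%:Z).

Definition Farey_pair (n : nat) (x y : rat) : Prop :=
  [/\ in_Farey n x, in_Farey n y, x < y &
      forall w : rat, in_Farey n w -> ~ (x < w < y)].

(* The complex number 0 has no argument *)
Definition has_argument (R : realType) (lambda : R[i]) (theta : R) : Prop :=
  lambda != 0 /\ lambda = `|lambda| * (cos theta +i* sin theta).

Definition Karpelevic_arc_ordered (R : realType) (n a b : nat) : set R[i] :=
  [set lambda | boundary (@Theta R n) lambda /\
    exists p r : nat,
      [/\ coprime p a, coprime r b, Farey_pair n (p%:Q / a%:Q) (r%:Q / b%:Q) &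
      exists2 theta : R, has_argument lambda theta &
        2 * pi * p%:R / a%:R < theta < 2 * pi * r%:R / b%:R \/
        2 * pi * (b%:R - r%:R) / b%:R < theta
          < 2 * pi * (a%:R - p%:R) / a%:R]].

(* K_n(a,b) = K_n(b,a): the smaller denominator comes first in the Farey pair *)
Definition Karpelevic_arc (R : realType) (n a b : nat) : set R[i] :=
  @Karpelevic_arc_ordered R n (minn a b) (maxn a b).

Definition Karpelevic_mx (R : realType) (n a b : nat) : set 'M[R]_n :=
  [set A | stochastic A /\
    exists2 lambda, complex_eigenvalue A lambda & Karpelevic_arc n a b lambda].

Definition Karpelevic_mx_min (R : realType) (n a b : nat) : set 'M[R]_n :=
  [set A | Karpelevic_mx a b A /\
    forall A' : 'M[R]_n, Karpelevic_mx a b A' ->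
      ~~ (nonzero_positions A' \proper nonzero_positions A)].

(* Edges of Gamma^II_z between vertices labelled 1, ..., QD, where D = size z;
   here i ranges over 0, ..., D - 1, so block i is {iQ + 1, ..., (i + 1)Q} and
   nth 0 z i is the i+1st entry of z *)
Definition typeII_edge (Q : nat) (z : seq nat) : rel nat :=
  fun u v => [exists i : 'I_(size z),
    cycle_edge (iota (i * Q).+1 Q) u v ||
    (u == i.+1 * Q - nth 0 z i)%N &&
      (v == angle_mod (1 + i.+1 * Q)%N (Q * size z))].

(* The ordinal k is the vertex labelled k + 1 *)
Definition typeII_digraph (Q : nat) (z : seq nat) : rel 'I_(Q * size z) :=
  fun u v => typeII_edge Q z u.+1 v.+1.

Definition typeII_form (Q D : nat) (R : realType) (n : nat) (A : 'M[R]_n)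
    (z : seq nat) : Prop :=
  [/\ stochastic A, size z = D, (sumn z <= Q - 1)%N &
      digraph_iso (digraph_mx A) (@typeII_digraph Q z)].

Definition cyclic_rotations (T : Type) (s : seq T) : set (seq T) :=
  [set rot k s | k in [set: nat]].

(* P_II(A) with respect to Q, D; it is empty when A is not of type II form.
   Taking all z of which A is the type II form builds in no choice of z. *)
Definition partition_class_II (Q D : nat) (R : realType) (n : nat)
    (A : 'M[R]_n) : set (seq nat) :=
  [set s | exists2 z, typeII_form Q D A z & cyclic_rotations z s].

(* sigma restricts to a single cycle on the duplicate-free sequence I *)
Definition single_cycle (T : eqType) (I : seq T) (sigma : T -> T) : Prop :=
  exists2 s, perm_eq s I & fcycle sigma s.

(* "P consists of the parts x iota, iota \in I, where x iota is followed by
   x (sigma iota)" *)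
Definition consists_of_parts (T : eqType) (U : Type) (P : set (seq U))
    (I : seq T) (x : T -> U) (sigma : T -> T) : Prop :=
  single_cycle I sigma /\
  exists2 iota0, iota0 \in I &
    P = cyclic_rotations [seq x k | k <- traject sigma iota0 (size I)].

(* The indices i, j below are 1-based, and zhat = [:: zhat_1; ...; zhat_d] *)
Definition part_hat (zhat : seq nat) (i : nat) : nat := nth 0%N zhat i.-1.

Definition beta_part (c : nat) (zhat : seq nat) (i : nat) : int :=
  c%:Z - (angle_mod (part_hat zhat i) c)%:Z.

(* An exact division when c > 0; w_i = -1 when zhat_i = 0 *)
Definition w_part (c : nat) (zhat : seq nat) (i : nat) : int :=
  (((part_hat zhat i)%:Z - (angle_mod (part_hat zhat i) c)%:Z) %/ c)%Z.

Definition z_part (c : nat) (zhat : seq nat) (ij : nat * nat) : int :=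
  if (ij.2%:Z <= beta_part c zhat ij.1) then w_part c zhat ij.1
  else w_part c zhat ij.1 + 1.

Definition part_indices (c d : nat) : seq (nat * nat) :=
  [seq (i, j) | i <- iota 1 d, j <- iota 1 c].

Definition next_part (c d : nat) (zhat : seq nat) (ij : nat * nat) :
    nat * nat :=
  (angle_mod (ij.1%:Z + 1) d,
   angle_mod (ij.2%:Z - beta_part c zhat ij.1) c).

(* Main.v *)
(* Write Q = c q, and let Z be the sum of the parts of B. A walk of length c in
   Gamma^II_zhat stays inside its block or crosses over to the next block exactly
   once, so the digraph of B^c splits each block of B into its c residue classes
   modulo c; class rho of block i is followed by class (rho + zhat_i) mod c of
   block i + 1, and its part is the quotient (rho + zhat_i) / c. These classes
   form a single cycle as soon as Z is coprime to c, and an isomorphism between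
   two digraphs Gamma^II preserves the branching vertices, hence the parts up to
   rotation.

   It remains to see that Z = z when c > 1. The eigenvalue lambda = rho e^(i theta)
   of B on the Karpelevic arc satisfies
     prod_i (lambda^Q - a_i) = prod_i (1 - a_i) lambda^Z  with 0 < a_i < 1.
   With phi the argument of lambda^Q and phi + eta_i that of lambda^Q - a_i, this
   becomes prod_i f(eta_i) = rho^(QD - Z), where
   f(x) = (sin(phi + x) - rho^Q sin x) / sin phi is log-concave with f(0) = 1,
   while sum_i eta_i is determined modulo 2 pi by theta and Z. As theta / 2 pi lies
   between two Farey neighbours, unimodularity leaves only Z = z or a sum so large
   that concavity yields f(kappa)^D > rho^(QD - z) for the argument kappa belonging
   to z. That strict inequality is open in lambda and implies lambda in Theta_n, so
   lambda would be an interior point of Theta_n. *)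
Require Import Defs.
From mathcomp Require Import all_boot all_order all_algebra.
From mathcomp Require Import complex zify ring lra.
From mathcomp Require Import all_classical all_reals all_analysis.

Set Implicit Arguments.
Unset Strict Implicit.
Unset Printing Implicit Defensive.

Import Order.TTheory GRing.Theory Num.Theory.
Import numFieldNormedType.Exports.
Local Open Scope classical_set_scope.
Local Open Scope ring_scope.

(** * The digraphs of type II and their powers *)

Lemma divnMDsmall (Q i r : nat) : (r < Q)%N -> ((i * Q + r) %/ Q = i)%N.
Proof. by move=> rQ; rewrite divnMDl ?divn_small ?addn0 //; lia. Qed.

Lemma modnMDsmall (Q i r : nat) : (r < Q)%N -> ((i * Q + r) %% Q = r)%N.
Proof. by move=> rQ; rewrite modnMDl modn_small. Qed.

Lemma ltn_MDsmall (Q D i r : nat) :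
  (i < D)%N -> (r < Q)%N -> (i * Q + r < Q * D)%N.
Proof. nia. Qed.

Lemma eq_MDsmall (Q i r i' r' : nat) : (r < Q)%N -> (r' < Q)%N ->
  (i * Q + r == i' * Q + r')%N = (i == i') && (r == r').
Proof.
move=> rQ rQ'; apply/eqP/andP => [E|[/eqP-> /eqP->]//].
have := congr1 (divn^~ Q) E; have := congr1 (modn^~ Q) E.
by rewrite !divnMDsmall // !modnMDsmall // => -> ->.
Qed.

Lemma angle_modE (a m : nat) : (0 < m)%N ->
  angle_mod (Posz a.+1) m = (1 + a %% m)%N.
Proof.
by move=> m0; rewrite /angle_mod intS addrAC subrr add0r modz_nat.
Qed.

Lemma index_iota m Q k : (k < Q)%N -> index (m + k)%N (iota m Q) = k.
Proof.
move=> kQ; rewrite -[(m + k)%N](nth_iota 0 m kQ) index_uniq ?iota_uniq //.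
by rewrite size_iota.
Qed.

Lemma next_iota m Q k : (k < Q)%N ->
  next (iota m Q) (m + k)%N = (m + k.+1 %% Q)%N.
Proof.
move=> kQ; rewrite next_nth mem_iota leq_addr ltn_add2l kQ.
case: Q kQ => // Q kQ; rewrite index_iota // -/(iota _ _).
rewrite [iota m Q.+1]/=.
have [->|kneq] := eqVneq k Q.
  by rewrite nth_default ?size_iota // modnn addn0.
have kQ' : (k < Q)%N by move: kneq kQ; rewrite ltnS leq_eqVlt => /negPf->.
by rewrite nth_iota // modn_small // addSnnS.
Qed.

(* The edge relation of Gamma^II on the vertices 0, ..., QD - 1; vertex
   i * Q + r is the r-th vertex of block i. *)
Definition block_edge (Q D : nat) (zf : nat -> nat) (u v : nat) : bool :=
  (v == u %/ Q * Q + (u %% Q).+1 %% Q)%N ||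
  (u %% Q + zf (u %/ Q) == Q.-1)%N && (v == (u %/ Q).+1 %% D * Q)%N.

Lemma block_edgeE (Q D : nat) (zf : nat -> nat) (i r v : nat) : (r < Q)%N ->
  block_edge Q D zf (i * Q + r) v = (v == i * Q + r.+1 %% Q)%N ||
    (r + zf i == Q.-1)%N && (v == i.+1 %% D * Q)%N.
Proof. by move=> rQ; rewrite /block_edge divnMDsmall // modnMDsmall. Qed.

Lemma nth_leq_sumn (s : seq nat) i : (nth 0 s i <= sumn s)%N.
Proof.
elim: s i => [|x s IH] [|i] //=; first exact: leq_addr.
by rewrite (leq_trans (IH i)) // leq_addl.
Qed.

(** The bound on [sumn z] keeps the truncated subtraction [j.+1 * Q - nth 0 z j] inside block j, so
    quotient and remainder by Q decide which edges leave a vertex. *)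
Lemma typeII_edgeE (Q : nat) (z : seq nat) (u v : nat) : (0 < Q)%N ->
  (sumn z <= Q - 1)%N -> (u < Q * size z)%N ->
  typeII_edge Q z u.+1 v.+1 = block_edge Q (size z) (nth 0%N z) u v.
Proof.
move=> Q0 zQ uQ.
have rQ := ltn_pmod u Q0; have iD : (u %/ Q < size z)%N by rewrite ltn_divLR // mulnC.
rewrite (divn_eq u Q); move: (u %/ Q)%N (u %% Q)%N rQ iD => i r rQ iD.
rewrite block_edgeE // /typeII_edge.
have eqE (j : 'I_(size z)) :
  (cycle_edge (iota (j * Q).+1 Q) (i * Q + r).+1 v.+1 =
    (j == i :> nat) && (v == i * Q + r.+1 %% Q)%N) *
  (((i * Q + r).+1 == j.+1 * Q - nth 0 z j)%N =
    (j == i :> nat) && (r + nth 0 z i == Q.-1)%N) *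
  ((v.+1 == angle_mod (1 + j.+1 * Q)%N (Q * size z)) =
     (v == (j.+1 %% size z) * Q)%N).
- have zj := nth_leq_sumn z j; split; first split.
  + rewrite /cycle_edge mem_iota.
    have -> : (((j * Q).+1 <= (i * Q + r).+1) && ((i * Q + r).+1 < (j * Q).+1 + Q) = (j == i :> nat))%N.
      apply/idP/eqP; last by move=> ->; nia.
      by move=> /andP[]; nia.
    case: eqP => //= ->; rewrite -addSn next_iota // addSn eqSS //.
  + have -> : (j.+1 * Q - nth 0 z j = (j * Q + (Q.-1 - nth 0 z j)).+1)%N by nia.
    rewrite eqSS eq_MDsmall //; last by lia.
    rewrite eq_sym; case: eqP => //= ->.
    have := nth_leq_sumn z i; lia.
  + rewrite add1n angle_modE; last by case: (size z) iD; nia.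
    by rewrite add1n eqSS (mulnC Q) muln_modl.
apply/existsP/idP.
  move=> [j]; rewrite !(eqE j) => /orP[/andP[_ ->]//|].
  by move=> /andP[/andP[/eqP<- ->] ->]; rewrite orbT.
by exists (Ordinal iD); rewrite !(eqE (Ordinal iD)) /= eqxx.
Qed.

(** * Walks and powers of nonnegative matrices *)

Fixpoint walk (T : finType) (e : rel T) (k : nat) (u v : T) : bool :=
  if k is k'.+1 then [exists w, walk e k' u w && e w v] else u == v.

Lemma walk_iso (T T' : finType) (e : rel T) (e' : rel T') (f : T -> T') k u v :
  bijective f -> (forall u v, e u v = e' (f u) (f v)) ->
  walk e k u v = walk e' k (f u) (f v).
Proof.
move=> bf ef; elim: k v => [|k IH] v /=; first by rewrite (inj_eq (bij_inj bf)).
case: bf => g fK gK; apply/existsP/existsP => -[w /andP[uw wv]].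
  by exists (f w); rewrite -IH uw -ef.
by exists (g w); rewrite IH ef gK uw.
Qed.

(** Nonnegative terms cannot cancel, so one walk suffices for a nonzero entry. Nonnegativity of the
    power is carried along because the induction needs it. *)
Lemma digraph_expmx (R : realType) (n k : nat) (A : 'M[R]_n) (u v : 'I_n) :
  (forall i j, 0 <= A i j) ->
  0 <= (A ^+ k) u v /\ digraph_mx (A ^+ k) u v = walk (digraph_mx A) k u v.
Proof.
move=> A0; elim: k v => [|k IH] v.
  rewrite expr0 /digraph_mx /= !mxE.
  by case: eqP => _; rewrite ?mulr1n ?mulr0n ?ler01 ?lexx ?oner_neq0 ?eqxx.
have kA w : 0 <= (A ^+ k) u w * A w v by rewrite mulr_ge0 //; have [] := IH w.
rewrite exprSr /digraph_mx /= !mxE; split; first exact: sumr_ge0.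
rewrite psumr_neq0 //; apply/hasP/existsP => -[w].
  move=> _ /=; rewrite lt0r mulf_eq0 negb_or => /andP[/andP[kw wv] _].
  by exists w; have [_ <-] := IH w; apply/andP.
have [_ <-] := IH w; move=> /andP[kw wv]; exists w; first exact: mem_index_enum.
by rewrite /= lt0r kA andbT; exact: mulf_neq0.
Qed.

Lemma stochastic_exp (R : realType) (n k : nat) (A : 'M[R]_n) :
  stochastic A -> stochastic (A ^+ k).
Proof.
move=> [A0 A1]; split=> [u v|u]; first by have [] := digraph_expmx k u v A0.
elim: k => [|k IH].
  rewrite expr0 (bigD1 u) //= mxE eqxx big1 ?addr0 // => j ju.
  by rewrite mxE eq_sym (negPf ju).
rewrite exprSr -IH; under eq_bigr do rewrite mxE.
by rewrite exchange_big; apply: eq_bigr => w _; rewrite -mulr_sumr A1 mulr1.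
Qed.

(** Every part is below q, so the branching vertex of a block has position at least Q - q >= c - 1.
    Within c steps, a walk that has entered a block at its first vertex makes no further
    crossing. *)
Lemma walk_typeII (c q : nat) (zs : seq nat) (k : nat)
    (u v : 'I_(c * q * size zs)) (i r : nat) :
  (0 < c)%N -> (0 < q)%N -> (sumn zs <= q - 1)%N -> (k <= c)%N ->
  (i < size zs)%N -> (r < c * q)%N -> u = (i * (c * q) + r)%N :> nat ->
  walk (@typeII_digraph (c * q) zs) k u v =
    (val v == i * (c * q) + (r + k) %% (c * q))%N ||
    (r + nth 0 zs i < c * q <= r + nth 0 zs i + k)%N &&
    (val v == (i.+1 %% size zs) * (c * q) + (r + nth 0 zs i + k - c * q))%N.
Proof.
move=> c0 q0 zq; set Q := (c * q)%N in u v *.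
have Q0 : (0 < Q)%N by rewrite muln_gt0 c0.
have zQ : (sumn zs <= Q - 1)%N by rewrite (leq_trans zq) // leq_sub2r // leq_pmull.
have zi j : (nth 0 zs j <= q - 1)%N := leq_trans (nth_leq_sumn zs j) zq.
(* This is (c - 1)(q - 1) >= 0. *)
have cqQ : (c + q <= Q.+1)%N by rewrite /Q; nia.
move=> kc iD rQ uE.
have D0 : (0 < (size zs))%N by exact: leq_ltn_trans iD.
have iD' : (i.+1 %% (size zs) < (size zs))%N by exact: ltn_pmod.
have eE (w w' : 'I_(Q * (size zs))) : typeII_digraph w w' = block_edge Q (size zs) (nth 0%N zs) w w'.
  by rewrite /typeII_digraph typeII_edgeE.
have zi1 := zi i; have zi2 := zi (i.+1 %% size zs)%N.
elim: k kc v => [|k IH] kc v.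
  rewrite /= -val_eqE /= uE addn0 modn_small // eq_sym addn0.
  by rewrite (leqNgt Q) andbN orbF.
have {}IH := IH (ltnW kc).
have rkQ : ((r + k) %% Q < Q)%N by exact: ltn_pmod.
(* After wrapping round the block, the walk stands below position c - 1 and cannot be at the
   branching vertex. *)
have noflip : ((r + k) %% Q + nth 0 zs i == Q.-1)%N -> (r + k < Q)%N.
  move=> /eqP E; rewrite ltnNge; apply/negP => Qrk.
  have rkE : ((r + k) %% Q = r + k - Q)%N.
    rewrite -{1}(subnK Qrk) modnDr modn_small //.
    by move: rQ kc cqQ q0; clear; lia.
  by rewrite rkE in E; move: rQ kc cqQ q0 zi1 E Qrk; clear; lia.
have rS : (((r + k) %% Q).+1 %% Q = (r + k.+1) %% Q)%N.
  by rewrite -addn1 modnDml addn1 addnS.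
(* Likewise, after a crossing the position is at most c - 2, short of the branching vertex of the
   next block. *)
have crossed : (r + nth 0 zs i < Q <= r + nth 0 zs i + k)%N ->
    ((r + nth 0 zs i + k - Q).+1 < Q)%N /\
    (r + nth 0 zs i + k - Q + nth 0 zs (i.+1 %% size zs) < Q.-1)%N.
  move=> /andP[rz rz']; split.
    by move: kc cqQ q0 rz rz'; clear; lia.
  by move: kc cqQ q0 zi2 rz rz'; clear; lia.
rewrite [walk _ _ _ _]/=; apply/existsP/idP => [[w]|].
  rewrite IH eE => /andP[/orP[/eqP wE|/andP[rz /eqP wE]]]; rewrite /= in wE; rewrite wE.
    rewrite block_edgeE // rS; case/orP => [->//|/andP[E vE]].
    have rkQ' := noflip E; rewrite modn_small // in E.
    have [-> ->] : (r + nth 0 zs i < Q <= r + nth 0 zs i + k.+1)%N /\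
        (r + nth 0 zs i + k.+1 - Q = 0)%N.
      by move: E Q0; clear; lia.
    by rewrite addn0 -(eqP vE) eqxx orbT.
  have [pQ /ltn_eqF pz] := crossed rz.
  rewrite block_edgeE ?pz ?orbF; last exact: ltnW.
  rewrite (@modn_small _ Q) // => /eqP vE.
  have [-> ->] : (r + nth 0 zs i < Q <= r + nth 0 zs i + k.+1)%N /\
      (r + nth 0 zs i + k.+1 - Q = (r + nth 0 zs i + k - Q).+1)%N.
    by move: rz; clear; lia.
  by rewrite /= vE eqxx orbT.
pose w1 := Ordinal (ltn_MDsmall iD rkQ).
case/orP => [vE|/andP[rz vE]].
  by exists w1; rewrite IH eE /= eqxx /= block_edgeE // rS vE.
have [Qrz|rzQ] := leqP Q (r + nth 0%N zs i + k).
  have rz' : (r + nth 0 zs i < Q <= r + nth 0 zs i + k)%N by case/andP: rz => ->.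
  have [pQ pz] := crossed rz'; have pQ' := ltnW pQ.
  exists (Ordinal (ltn_MDsmall iD' pQ')); rewrite IH eE /= eqxx rz' orbT /=.
  rewrite block_edgeE // (@modn_small _ Q) //; apply/orP; left.
  by rewrite -[X in (_ + X)%N](subSn Qrz) -addnS.
exists w1; rewrite IH eE /= eqxx /= block_edgeE //.
have [rkE E pE] : [/\ (r + k < Q)%N, (r + k + nth 0 zs i = Q.-1)%N &
    (r + nth 0 zs i + k.+1 - Q = 0)%N].
  by move: rz rzQ; clear; split; lia.
rewrite pE addn0 in vE.
by rewrite [((r + k) %% Q)%N]modn_small // E eqxx /= [X in _ || X]vE orbT.
Qed.

(** * Superblocks of the power and the long cycle through them *)

Definition cyclic_psum (zs : seq nat) (k : nat) : nat :=
  (\sum_(j < k) nth 0 zs (j %% size zs))%N.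

(* The superblocks of the c-th power are the pairs (block, residue mod c); the
   k-th one met along the long cycle is (k mod size zs, cyclic_psum zs k mod c). *)
Definition power_part (c : nat) (zs : seq nat) (k : nat) : nat :=
  ((cyclic_psum zs k %% c + nth 0 zs (k %% size zs)) %/ c)%N.

Definition power_parts (c : nat) (zs : seq nat) : seq nat :=
  mkseq (power_part c zs) (c * size zs).

Lemma cyclic_psumS zs k :
  cyclic_psum zs k.+1 = (cyclic_psum zs k + nth 0 zs (k %% size zs))%N.
Proof. by rewrite /cyclic_psum big_ord_recr. Qed.

Lemma cyclic_psum_size zs : cyclic_psum zs (size zs) = sumn zs.
Proof.
rewrite sumnE (big_nth 0%N) big_mkord; apply: eq_bigr => j _.
by rewrite modn_small.
Qed.

Lemma cyclic_psumMD zs l k :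
  cyclic_psum zs (l * size zs + k) = (l * sumn zs + cyclic_psum zs k)%N.
Proof.
elim: k => [|k IH]; last by rewrite addnS !cyclic_psumS IH modnMDl addnA.
rewrite addn0 /cyclic_psum big_ord0 addn0.
elim: l => [|l IH]; first by rewrite big_ord0.
rewrite mulSn addnC !mulSn [RHS]addnC big_split_ord /= IH; congr addn.
rewrite -cyclic_psum_size; apply: eq_bigr => j _.
by rewrite modnMDl.
Qed.

Lemma power_part_step c zs k :
  (cyclic_psum zs k %% c + nth 0 zs (k %% size zs) =
   power_part c zs k * c + cyclic_psum zs k.+1 %% c)%N.
Proof. by rewrite cyclic_psumS -modnDml -divn_eq. Qed.

(** Each part is the increment of [cyclic_psum zs k %/ c], hence the sum telescopes. *)
Lemma sum_power_part c zs K : (0 < c)%N ->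
  (\sum_(k < K) power_part c zs k = cyclic_psum zs K %/ c)%N.
Proof.
move=> c0; elim: K => [|K IH]; first by rewrite /cyclic_psum !big_ord0 div0n.
rewrite big_ord_recr /= IH cyclic_psumS.
by rewrite /power_part [in RHS](divn_eq (cyclic_psum zs K) c) -addnA divnMDl.
Qed.

Lemma sumn_power_parts c zs : (0 < c)%N -> sumn (power_parts c zs) = sumn zs.
Proof.
move=> c0; rewrite sumnE big_map -[X in iota 0 X]subn0 big_mkord.
rewrite sum_power_part // -[(c * _)%N]addn0 cyclic_psumMD.
by rewrite /cyclic_psum big_ord0 addn0 mulKn.
Qed.

(** One step of the power inside a block advances by c, so vertex t of the k-th superblock, labelled
    [k * q + t], is the t-th member of a residue class modulo c. *)
Definition power_vertex (c q : nat) (zs : seq nat) (m : nat) : nat :=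
  (m %/ q %% size zs * (c * q) + (m %% q * c + cyclic_psum zs (m %/ q) %% c))%N.

Lemma power_vertexE c q zs k t : (t < q)%N ->
  power_vertex c q zs (k * q + t) =
  (k %% size zs * (c * q) + (t * c + cyclic_psum zs k %% c))%N.
Proof. by move=> tq; rewrite /power_vertex divnMDsmall // modnMDsmall. Qed.

Lemma ltn_vertex c q t r : (t < q)%N -> (r < c)%N -> (t * c + r < c * q)%N.
Proof. by move=> tq rc; exact: ltn_MDsmall. Qed.

Lemma power_vertex_lt c q zs m : (0 < c)%N -> (m < q * (c * size zs))%N ->
  (power_vertex c q zs m < c * q * size zs)%N.
Proof.
move=> c0 mlt; have q0 : (0 < q)%N by case: q mlt.
have D0 : (0 < size zs)%N by case: (size zs) mlt => //; rewrite !muln0.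
by rewrite /power_vertex ltn_MDsmall ?ltn_mod // ltn_vertex ?ltn_mod.
Qed.

(** A full round of the blocks adds [sumn zs], a unit modulo c, so a residue recurs in the same
    block only after c rounds. *)
Lemma cyclic_psum_inj c zs k k' : (0 < c)%N -> coprime c (sumn zs) ->
  (k < c * size zs)%N -> (k' < c * size zs)%N ->
  (k = k' %[mod size zs])%N ->
  (cyclic_psum zs k = cyclic_psum zs k' %[mod c])%N -> k = k'.
Proof.
move=> c0 cop; wlog: k k' / (k <= k')%N => [hw kc kc' kk pp|].
  have [le|/ltnW le] := leqP k k'; first exact: hw.
  by apply/esym/hw.
move=> kk' _ kc' /eqP kD /eqP kp.
move: kD; rewrite eq_sym eqn_mod_dvd // => /dvdnP[l lE].
have k'E : k' = (l * size zs + k)%N by rewrite -lE subnK.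
move: kp; rewrite eq_sym k'E cyclic_psumMD eqn_mod_dvd ?leq_addl // addnK.
rewrite Gauss_dvdl // => /dvdnP[[|l'] l'E]; first by rewrite l'E !mul0n.
by move: kc'; rewrite ltnNge k'E l'E mulSn; nia.
Qed.

Lemma power_vertex_inj c q zs m m' : (0 < c)%N -> coprime c (sumn zs) ->
  (m < q * (c * size zs))%N -> (m' < q * (c * size zs))%N ->
  power_vertex c q zs m = power_vertex c q zs m' -> m = m'.
Proof.
move=> c0 cop mlt mlt'; have q0 : (0 < q)%N by case: q mlt {mlt'}.
have lt1 a : (a %% q * c + cyclic_psum zs (a %/ q) %% c < c * q)%N.
  by rewrite ltn_vertex ?ltn_mod.
move=> /eqP; rewrite eq_MDsmall // => /andP[/eqP kE].
rewrite eq_MDsmall ?ltn_mod // => /andP[/eqP tE /eqP pE].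
rewrite (divn_eq m q) (divn_eq m' q) tE; congr (_ * _ + _)%N.
by apply: (@cyclic_psum_inj c zs) => //; rewrite ltn_divLR // mulnC.
Qed.

Lemma power_walk_typeII (c q : nat) (zs : seq nat) :
  (0 < c)%N -> (0 < q)%N -> (0 < size zs)%N -> (sumn zs <= q - 1)%N ->
  coprime c (sumn zs) ->
  digraph_iso (walk (@typeII_digraph (c * q) zs) c)
    (@typeII_digraph q (power_parts c zs)).
Proof.
move=> c0 q0 D0 zq cop.
have szE : size (power_parts c zs) = (c * size zs)%N by rewrite size_mkseq.
have lt1 (m : 'I_(q * size (power_parts c zs))) : (m < q * (c * size zs))%N.
  by rewrite -szE.
pose G (m : 'I_(q * size (power_parts c zs))) :=
  Ordinal (power_vertex_lt c0 (lt1 m)).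
have [F GK FK] : bijective G.
  apply: inj_card_bij; last by rewrite !card_ord szE mulnCA mulnA.
  by move=> m m' /(congr1 val)/(power_vertex_inj c0 cop (lt1 _) (lt1 _))/val_inj.
exists F => [|u v]; first by exists G.
have zq' : (sumn (power_parts c zs) <= q - 1)%N by rewrite sumn_power_parts.
rewrite -{1}(FK u) -{1}(FK v); move: (F u) (F v) => m m' {u v F GK FK}.
rewrite [RHS]typeII_edgeE //; move: (lt1 m) (lt1 m').
have uE : G m = power_vertex c q zs m :> nat by [].
have vE : val (G m') = power_vertex c q zs m' by [].
move: (G m) (G m') uE vE => u v uE vE mlt mlt'.
have eqv a : (a < q * (c * size zs))%N ->
    (val m' == a) = (val v == power_vertex c q zs a).
  move=> alt; rewrite vE; apply/eqP/eqP => [->//|].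
  exact: power_vertex_inj.
move: (nat_of_ord m) mlt uE => {}m mlt.
have tq := ltn_pmod m q0.
have kc : (m %/ q < c * size zs)%N by rewrite ltn_divLR // [(_ * q)%N]mulnC.
rewrite (divn_eq m q); move: (m %/ q)%N (m %% q)%N tq kc => k t tq kc.
rewrite power_vertexE // => uE.
have kD : (k %% size zs < size zs)%N by rewrite ltn_mod.
have pc j : (cyclic_psum zs j %% c < c)%N by rewrite ltn_mod.
rewrite (walk_typeII v c0 q0 zq (leqnn c) kD (ltn_vertex tq (pc k)) uE).
rewrite block_edgeE //= !eqv ?szE //; first last.
- by rewrite ltn_MDsmall // ltn_mod.
- by rewrite mulnC ltn_pmul2l // ltn_mod muln_gt0 c0.
rewrite power_vertexE ?ltn_mod // nth_mkseq //; congr (orb (@eq_op nat _ (addn _ _)) _).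
  rewrite -addnA [(_ %% c + c)%N]addnC addnA -mulSnr.
  have [tq'|qt] := ltnP t.+1 q; first by rewrite (modn_small tq') (modn_small (ltn_vertex tq' (pc k))).
  have -> : t.+1 = q by lia.
  by rewrite modnn mul0n add0n [(q * c)%N]mulnC modnDl (@modn_small _ (c * q)) // (leq_trans (pc k)) // leq_pmulr.
rewrite -addnA power_part_step.
set w := power_part c zs k; have := pc k.+1; set p := (cyclic_psum zs k.+1 %% c)%N => pc1.
(* Since p < c, a crossing within c steps starts only from the vertex with t + w = q - 1, where w is
   the part of the superblock. *)
have -> : (t * c + (w * c + p) < c * q <= t * c + (w * c + p) + c)%N = (t + w == q.-1)%N.
  clearbody w p; apply/idP/eqP => [/andP[]|].
    by move: pc1; clear; nia.
  move=> /eqP/esym E; have -> : q = (t + w).+1 by lia.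
  by apply/andP; split; nia.
have [E|//] := eqVneq (t + w)%N q.-1; rewrite /=.
have -> : (t * c + (w * c + p) + c - c * q = p)%N.
  by have -> : q = (t + w).+1; [lia|nia].
rewrite -[(_ %% _ * q)%N]addn0 power_vertexE // mul0n add0n modn_dvdm ?dvdn_mull //.
rewrite -addn1 modnDml addn1; congr (@eq_op nat _ (addn _ _)).
have [kc'|kc'] := ltnP k.+1 (c * size zs); first by rewrite (modn_small kc').
(* The last superblock leads back to the first: after c rounds the running sum is a multiple of
   c. *)
have kE : k.+1 = (c * size zs)%N by lia.
rewrite kE modnn /p kE -[(c * _)%N]addn0 cyclic_psumMD.
by rewrite [(c * _)%N]mulnC modnMDl.
Qed.

(** * Branching vertices and isomorphisms between type II digraphs *)

Definition in_branching (e : rel nat) (N v : nat) : Prop :=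
  exists a b, [/\ (a < N)%N, (b < N)%N, a != b, e a v & e b v].

Definition out_branching (e : rel nat) (N u : nat) : Prop :=
  exists a b, [/\ (a < N)%N, (b < N)%N, a != b, e u a & e u b].

(* When D = 1 and z_1 = 0 the extra edge coincides with an edge of the cycle,
   so that Gamma^II has no branching at all. *)
Definition branched (D : nat) (zf : nat -> nat) : bool :=
  (1 < D)%N || (0 < zf 0)%N.

Lemma blockP (Q D u : nat) : (u < Q * D)%N ->
  exists i r, [/\ (i < D)%N, (r < Q)%N & u = (i * Q + r)%N].
Proof.
move=> uN; have Q0 : (0 < Q)%N by case: Q uN.
exists (u %/ Q)%N, (u %% Q)%N; split; last exact: divn_eq.
  by rewrite ltn_divLR // mulnC.
exact: ltn_pmod.
Qed.

Lemma eq_succ_mod (D i : nat) : (i < D)%N -> i = (i.+1 %% D)%N -> D = 1%N.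
Proof.
move=> iD; have [lt|] := ltnP i.+1 D; first by rewrite modn_small //; lia.
by move=> le; have -> : i.+1 = D by [lia]; rewrite modnn; lia.
Qed.

(** Crossing edges end at first vertices, so any other vertex has only its predecessor in the block.
    In a single block with part 0 the crossing edge repeats the closing edge of the cycle. *)
Lemma in_branching_block Q D zf v : (forall i, zf i <= Q.-1)%N ->
  (v < Q * D)%N -> in_branching (block_edge Q D zf) (Q * D) v ->
  (v %% Q = 0)%N /\ branched D zf.
Proof.
move=> zQ vN [a [b [aN bN ab]]].
have [i [r [iD rQ ->]]] := blockP vN; rewrite modnMDsmall //.
have [j [s [jD sQ aE]]] := blockP aN; have [j' [s' [jD' sQ' bE]]] := blockP bN.
have Q0 : (0 < Q)%N by exact: leq_ltn_trans sQ.
subst a b; move: ab; rewrite !block_edgeE //.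
have sE x t : (t < Q)%N -> (i * Q + r == x * Q + t.+1 %% Q)%N -> (i = x /\ r = t.+1 %% Q)%N.
  by move=> tQ; rewrite eq_MDsmall ?ltn_mod // => /andP[/eqP-> /eqP->].
have jE y : (i * Q + r == y * Q)%N -> r = 0%N.
  by rewrite -[(y * Q)%N]addn0 eq_MDsmall // => /andP[_ /eqP].
have [r0|r0] := posnP r; last first.
  move=> ab /orP[/(sE _ _ sQ)[ij rs]|/andP[_ /jE]]; last by lia.
  case/orP => [/(sE _ _ sQ')[ij' rs']|/andP[_ /jE]]; last by lia.
  suff: (j == j') && (s == s') by rewrite -(@eq_MDsmall Q) // (negPf ab).
  rewrite -ij -ij' eqxx /=; have [le|lt] := leqP Q s.+1.
    by move: rs; have -> : s.+1 = Q by [lia]; rewrite modnn; lia.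
  have [le'|lt'] := leqP Q s'.+1.
    by move: rs'; have -> : s'.+1 = Q by [lia]; rewrite modnn; lia.
  by move: rs rs'; rewrite !modn_small // => -> [->].
move=> ab ea eb; split=> //; rewrite /branched.
have [//|D1] := ltnP 1 D; have {}D1 : D = 1%N.
  by apply/eqP; rewrite eqn_leq D1 (leq_ltn_trans _ iD).
have D0 x : (x < D)%N -> x = 0%N by rewrite D1 ltnS leqn0 => /eqP.
have j0 := D0 _ jD; have j0' := D0 _ jD'; have i0 := D0 _ iD.
rewrite /= lt0n; apply/eqP => z0; move: ab; rewrite j0 j0' !mul0n !add0n => /eqP; apply.
have last1 t : (t < Q)%N -> (0 == t.+1 %% Q)%N -> t = Q.-1.
  move=> tQ; rewrite leq_eqVlt in tQ; case/orP: tQ => [/eqP<-//|tQ].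
  by rewrite modn_small.
move: ea eb; rewrite i0 r0 j0 j0' z0 !mul0n !addn0 !add0n.
case/orP => [/(last1 _ sQ)->|/andP[/eqP-> _]].
  by case/orP => [/(last1 _ sQ')->|/andP[/eqP-> _]].
by case/orP => [/(last1 _ sQ')->|/andP[/eqP-> _]].
Qed.

Lemma first_in_branching Q D zf i : (0 < Q)%N -> (forall i, zf i <= Q.-1)%N ->
  (i < D)%N -> branched D zf ->
  in_branching (block_edge Q D zf) (Q * D) (i * Q).
Proof.
(* [i'] is the block before i; its branching vertex and the last vertex of block i are the two
   predecessors. *)
move=> Q0 zQ iD br; set i' := ((i + D.-1) %% D)%N.
have D0 : (0 < D)%N by exact: leq_ltn_trans iD.
have i'D : (i' < D)%N by rewrite ltn_mod.
have i'S : (i'.+1 %% D = i)%N.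
  by rewrite /i' -addn1 modnDml addn1 -addnS prednK // modnDr modn_small.
have zi := zQ i'; have Q1 : (Q.-1 < Q)%N by lia.
have zi' : (Q.-1 - zf i' < Q)%N by lia.
exists (i * Q + Q.-1)%N, (i' * Q + (Q.-1 - zf i'))%N.
rewrite !ltn_MDsmall // eq_MDsmall // !block_edgeE // i'S prednK // modnn addn0.
rewrite eqxx subnK // !eqxx orbT; split=> //.
apply/negP => /andP[/eqP ii' /eqP zE].
have D1 : D = 1%N by apply: (eq_succ_mod i'D); rewrite i'S.
move: br; rewrite /branched D1 /=; have -> : 0%N = i' by lia.
lia.
Qed.

Lemma out_branching_block Q D zf i r : (r < Q)%N ->
  out_branching (block_edge Q D zf) (Q * D) (i * Q + r) ->
  (r + zf i = Q.-1)%N.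
Proof.
move=> rQ [a [b [_ _ ab]]]; rewrite !block_edgeE //.
have [//|ne] := eqVneq (r + zf i)%N Q.-1; rewrite /= !orbF => /eqP aE /eqP bE.
by rewrite aE bE eqxx in ab.
Qed.

Lemma block_out_branching Q D zf i r : (i < D)%N -> (r < Q)%N ->
  (r + zf i = Q.-1)%N -> branched D zf ->
  out_branching (block_edge Q D zf) (Q * D) (i * Q + r).
Proof.
move=> iD rQ rz br; have Q0 : (0 < Q)%N by exact: leq_ltn_trans rQ.
have D0 : (0 < D)%N by exact: leq_ltn_trans iD.
exists (i * Q + r.+1 %% Q)%N, (i.+1 %% D * Q + 0)%N.
rewrite !ltn_MDsmall ?ltn_mod // !block_edgeE // rz addn0 !eqxx orbT; split=> //.
rewrite -[(i.+1 %% D * Q)%N]addn0 eq_MDsmall ?ltn_mod //.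
apply/negP => /andP[/eqP iS /eqP r1].
have D1 := eq_succ_mod iD iS; move: br; rewrite /branched D1 /=.
have -> : 0%N = i by lia.
have [lt|] := ltnP r.+1 Q; last by lia.
by move: r1; rewrite modn_small.
Qed.

(** Once there is branching, the in-branching vertices are the first vertices, so an isomorphism
    permutes the blocks. The distance from a first vertex to the out-branching vertex of its block
    recovers the part, and the crossing edges force the permutation to be a shift. *)
Lemma block_iso_shift (Q D : nat) (zf zf' h g : nat -> nat) :
  (0 < Q)%N -> (0 < D)%N ->
  (forall i, zf i <= Q.-1)%N -> (forall i, zf' i <= Q.-1)%N ->
  (forall u, u < Q * D -> h u < Q * D)%N ->
  (forall u, u < Q * D -> g u < Q * D)%N ->
  (forall u, u < Q * D -> g (h u) = u)%N ->
  (forall u, u < Q * D -> h (g u) = u)%N ->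
  (forall u v, (u < Q * D)%N -> (v < Q * D)%N ->
    block_edge Q D zf u v = block_edge Q D zf' (h u) (h v)) ->
  branched D zf ->
  exists t, (t < D)%N /\
    forall i, (i < D)%N -> zf i = zf' ((t + i) %% D)%N.
Proof.
move=> Q0 D0 zQ zQ' hN gN hK gK he br.
have hinj u v : (u < Q * D)%N -> (v < Q * D)%N -> h u = h v -> u = v.
  by move=> uN vN E; rewrite -(hK u uN) E hK.
have h_in v : (v < Q * D)%N -> in_branching (block_edge Q D zf) (Q * D) v ->
    in_branching (block_edge Q D zf') (Q * D) (h v).
  move=> vN [a [b [aN bN ab ea eb]]]; exists (h a), (h b).
  rewrite !hN // -!he //; split=> //; apply/eqP => /(hinj _ _ aN bN).
  exact/eqP.
have h_out v : (v < Q * D)%N -> out_branching (block_edge Q D zf) (Q * D) v ->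
    out_branching (block_edge Q D zf') (Q * D) (h v).
  move=> vN [a [b [aN bN ab ea eb]]]; exists (h a), (h b).
  rewrite !hN // -!he //; split=> //; apply/eqP => /(hinj _ _ aN bN).
  exact/eqP.
have g_out v : (v < Q * D)%N ->
    out_branching (block_edge Q D zf') (Q * D) (h v) ->
    out_branching (block_edge Q D zf) (Q * D) v.
  move=> vN [a [b [aN bN ab ea eb]]]; exists (g a), (g b).
  rewrite !gN // !he ?gN // !gK //; split=> //; apply/eqP => /(congr1 h).
  by rewrite !gK //; exact/eqP.
have lt0 i : (i < D)%N -> (i * Q < Q * D)%N.
  by move=> iD; rewrite -[(i * Q)%N]addn0 ltn_MDsmall.
pose t i := (h (i * Q) %/ Q)%N.
have hfirst i : (i < D)%N -> h (i * Q)%N = (t i * Q)%N /\ branched D zf'.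
  move=> iD; have hi := hN _ (lt0 _ iD).
  have [m0 br'] := in_branching_block zQ' hi (h_in _ (lt0 _ iD) (first_in_branching Q0 zQ iD br)).
  by split=> //; rewrite {1}(divn_eq (h (i * Q)) Q) m0 addn0.
have tD i : (i < D)%N -> (t i < D)%N.
  by move=> iD; rewrite /t ltn_divLR // [(D * Q)%N]mulnC; exact: hN _ (lt0 _ iD).
(* If the image of an edge before the branching vertex were a crossing, the source of that edge
   would branch, contrary to its position. *)
have hpath i k : (i < D)%N -> (k + zf i <= Q.-1)%N ->
    h (i * Q + k)%N = (t i * Q + k)%N.
  move=> iD; elim: k => [|k IH] kz; first by rewrite !addn0; have [] := hfirst i iD.
  have kQ : (k < Q)%N by lia. have kQ1 : (k.+1 < Q)%N by lia.
  have {}IH : h (i * Q + k)%N = (t i * Q + k)%N by apply: IH; lia.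
  have : block_edge Q D zf (i * Q + k) (i * Q + k.+1).
    by rewrite block_edgeE // modn_small // eqxx.
  rewrite he ?ltn_MDsmall // IH block_edgeE // => /orP[/eqP->|].
    by rewrite modn_small.
  case/andP => /eqP kz' _.
  have : out_branching (block_edge Q D zf) (Q * D) (i * Q + k).
    apply: g_out; first by rewrite ltn_MDsmall.
    rewrite IH; apply: block_out_branching => //; first exact: tD.
    by have [] := hfirst i iD.
  by move=> /(out_branching_block kQ); lia.
have htz i : (i < D)%N -> zf i = zf' (t i) /\ t (i.+1 %% D)%N = ((t i).+1 %% D)%N.
  move=> iD; have zi := zQ i; have zi' := zQ' (t i).
  have kz : (Q.-1 - zf i + zf i = Q.-1)%N by lia.
  move: kz; set k := (Q.-1 - zf i)%N => kz; have kQ : (k < Q)%N by lia.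
  have hu : h (i * Q + k)%N = (t i * Q + k)%N by apply: hpath; rewrite ?kz.
  have /h_out := block_out_branching iD kQ kz br.
  rewrite ltn_MDsmall // hu => /(_ isT) /(out_branching_block kQ) kz'.
  split; first by lia.
  have iSD : (i.+1 %% D < D)%N by rewrite ltn_mod.
  have : block_edge Q D zf (i * Q + k) (i.+1 %% D * Q).
    by rewrite block_edgeE // kz !eqxx orbT.
  rewrite he ?ltn_MDsmall ?lt0 // hu block_edgeE //.
  have [-> _] := hfirst _ iSD.
  case/orP; last first.
    by case/andP => _; rewrite eqn_pmul2r // => /eqP.
  (* If the crossing edge goes to an edge of a cycle, block i + 1 has the same image as block i;
     then D = 1 and the claim is trivial. *)
  rewrite -[X in X == _]addn0 eq_MDsmall ?ltn_mod // => /andP[/eqP tE _].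
  have iE : (i.+1 %% D * Q = i * Q)%N.
    by apply: hinj; rewrite ?lt0 //; have [-> _] := hfirst _ iSD; have [-> _] := hfirst _ iD; rewrite tE.
  have /(eq_succ_mod iD) D1 : i = (i.+1 %% D)%N.
    by apply/eqP; rewrite -(eqn_pmul2r Q0) iE.
  by rewrite tE; have := tD _ iD; rewrite D1 modn1; lia.
exists (t 0%N); split; first exact: tD.
move=> i iD; have [-> _] := htz i iD; congr zf'.
elim: i iD => [|i IH] iD; first by rewrite addn0 modn_small // tD.
have iD' := ltnW iD; have [_] := htz i iD'.
by rewrite (modn_small iD) => ->; rewrite IH // -addn1 modnDml addn1 addnS.
Qed.

Lemma nth_rot (z : seq nat) (t i : nat) : (t < size z)%N -> (i < size z)%N ->
  nth 0%N (rot t z) i = nth 0%N z ((t + i) %% size z)%N.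
Proof.
move=> tz iz; rewrite /rot nth_cat size_drop nth_drop.
have [lt|le] := ltnP i (size z - t); first by rewrite modn_small //; lia.
have -> : (t + i = i - (size z - t) + size z)%N by lia.
rewrite modnDr modn_small ?nth_take //; lia.
Qed.

Lemma digraph_iso_sym (T T' : finType) (e : rel T) (e' : rel T') :
  digraph_iso e e' -> digraph_iso e' e.
Proof.
move=> [f [g fK gK] fe]; exists g; first by exists f.
by move=> u v; rewrite fe !gK.
Qed.

Lemma digraph_iso_trans (T T' T'' : finType) (e : rel T) (e' : rel T')
    (e'' : rel T'') :
  digraph_iso e e' -> digraph_iso e' e'' -> digraph_iso e e''.
Proof.
move=> [f bf fe] [g bg ge]; exists (g \o f); first exact: bij_comp.
by move=> u v; rewrite fe ge.
Qed.

Lemma typeII_iso_branched (Q : nat) (z z' : seq nat) :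
  (0 < Q)%N -> (0 < size z)%N -> size z' = size z ->
  (sumn z <= Q - 1)%N -> (sumn z' <= Q - 1)%N ->
  branched (size z) (nth 0%N z) ->
  digraph_iso (@typeII_digraph Q z) (@typeII_digraph Q z') ->
  exists t, z = rot t z'.
Proof.
move=> Q0 D0 szE zQ zQ' br [f [g fK gK] fe].
have zi j : (nth 0 z j <= Q.-1)%N by rewrite -subn1 (leq_trans (nth_leq_sumn z j)).
have zi' j : (nth 0 z' j <= Q.-1)%N by rewrite -subn1 (leq_trans (nth_leq_sumn z' j)).
(* The vertices of the two digraphs have different ordinal types, so the isomorphism is carried over
   to labels, with default 0 outside the range. *)
pose h u := oapp (fun x : 'I_(Q * size z) => val (f x)) 0%N (insub u).
pose k u := oapp (fun x : 'I_(Q * size z') => val (g x)) 0%N (insub u).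
have hE (u : nat) (uN : (u < Q * size z)%N) : h u = f (Ordinal uN) by rewrite /h insubT.
have kE (u : nat) (uN : (u < Q * size z')%N) : k u = g (Ordinal uN) by rewrite /k insubT.
have [|||||t [tD tz]] := @block_iso_shift Q (size z) (nth 0%N z) (nth 0%N z') h k Q0 D0 zi zi' _ _ _ _ _ br.
- by move=> u uN; rewrite hE (leq_trans (ltn_ord (f (Ordinal uN)))) // szE.
- by move=> u; rewrite -{1}szE => uN; rewrite kE.
- by move=> u uN; rewrite hE /k valK /= fK.
- by move=> u; rewrite -{1}szE => uN; rewrite kE /h valK /= gK.
- move=> u v uN vN; rewrite !hE; have := fe (Ordinal uN) (Ordinal vN).
  rewrite /typeII_digraph !typeII_edgeE //=.
  move: (nat_of_ord (f (Ordinal uN))) (nat_of_ord (f (Ordinal vN))) => a b.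
  by rewrite szE.
exists t; apply: (@eq_from_nth _ 0%N) => [|i iD]; first by rewrite size_rot.
by rewrite tz // nth_rot ?szE.
Qed.

Lemma typeII_iso_rot (Q : nat) (z z' : seq nat) :
  (0 < Q)%N -> (0 < size z)%N -> size z' = size z ->
  (sumn z <= Q - 1)%N -> (sumn z' <= Q - 1)%N ->
  digraph_iso (@typeII_digraph Q z) (@typeII_digraph Q z') ->
  exists t, z = rot t z'.
Proof.
move=> Q0 D0 szE zQ zQ' iso.
have [br|nbr] := boolP (branched (size z) (nth 0%N z)).
  exact: typeII_iso_branched iso.
have [br'|nbr'] := boolP (branched (size z') (nth 0%N z')).
  have [||t z'E] := @typeII_iso_branched Q z' z Q0 _ _ zQ' zQ br' (digraph_iso_sym iso).
  - by rewrite szE.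
  - by rewrite szE.
  - by exists (size (rot t z) - t)%N; rewrite z'E -/(rotr t _) rotK.
(* Two unbranched digraphs both have a single block with part 0. *)
move: nbr nbr' D0; rewrite /branched szE; case: z szE {iso zQ} => [|x [|? ?]] //.
case: z' {zQ'} => [|x' [|? ?]] //= _; rewrite !lt0n !negbK => /eqP-> /eqP-> _.
by exists 0%N; rewrite rot0.
Qed.

Lemma typeII_rot_iso (Q : nat) (z : seq nat) (t : nat) :
  (0 < Q)%N -> (sumn z <= Q - 1)%N ->
  digraph_iso (@typeII_digraph Q (rot t z)) (@typeII_digraph Q z).
Proof.
move=> Q0 zQ; have [tD|] := ltnP t (size z); last first.
  by move=> /rot_oversize ->; exists id => //; exists id.
have D0 : (0 < size z)%N by exact: leq_ltn_trans tD.
have zQ' : (sumn (rot t z) <= Q - 1)%N by rewrite sumn_rot.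
pose G m := ((t + m %/ Q) %% size z * Q + m %% Q)%N.
have GN m : (G m < Q * size z)%N by rewrite ltn_MDsmall // ltn_mod.
have Ginj m m' : (m < Q * size z)%N -> (m' < Q * size z)%N -> G m = G m' -> m = m'.
  move=> /blockP[i [r [iD rQ ->]]] /blockP[i' [r' [iD' rQ' ->]]].
  move/eqP; rewrite /G !divnMDsmall // !modnMDsmall // eq_MDsmall //.
  by rewrite eqn_modDl !modn_small // => /andP[/eqP-> /eqP->].
have lt1 (m : 'I_(Q * size (rot t z))) : (m < Q * size z)%N by rewrite -(size_rot t z).
exists (fun m : 'I_(Q * size (rot t z)) => Ordinal (GN m)) => [|u v].
  apply: inj_card_bij; last by rewrite !card_ord size_rot.
  by move=> m m' /(congr1 val) /= /(Ginj _ _ (lt1 _) (lt1 _)) /val_inj.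
rewrite /typeII_digraph !typeII_edgeE //=.
move: (nat_of_ord u) (nat_of_ord v) (lt1 u) (lt1 v) => {}u {}v uN vN.
rewrite size_rot.
have [i [r [iD rQ uE]]] := blockP uN; subst u.
have GE j s : (s < Q)%N -> G (j * Q + s)%N = ((t + j) %% size z * Q + s)%N.
  by move=> sQ; rewrite /G divnMDsmall // modnMDsmall.
have Geq a : (a < Q * size z)%N -> (v == a) = (G v == G a).
  by move=> aN; apply/eqP/eqP => [->//|]; exact: Ginj.
rewrite GE // !block_edgeE // !Geq ?ltn_MDsmall ?ltn_mod //; last first.
  by rewrite -[X in (X < _)%N]addn0 ltn_MDsmall ?ltn_mod.
rewrite GE ?ltn_mod // nth_rot // -[(i.+1 %% _ * Q)%N]addn0 GE //.
by rewrite modnDmr -[((t + i) %% _).+1]addn1 modnDml addn1 addnS addn0.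
Qed.

Lemma rot_rotE (T : Type) (s : seq T) (m n : nat) :
  exists k, rot m (rot n s) = rot k s.
Proof.
rewrite [rot m _]rot_minn (rot_minn n) size_rot rot_add_mod ?geq_minr //.
by eexists.
Qed.

Lemma typeII_form_rot (Q D : nat) (R : realType) (n : nat) (A : 'M[R]_n)
    (z : seq nat) (t : nat) : (0 < Q)%N ->
  typeII_form Q D A z -> typeII_form Q D A (rot t z).
Proof.
move=> Q0 [stA szz zQ iso]; split => //; first by rewrite size_rot.
  by rewrite sumn_rot.
exact: (digraph_iso_trans iso (digraph_iso_sym (typeII_rot_iso t Q0 zQ))).
Qed.

(** Any two sequences giving a type II form of A have isomorphic digraphs, hence are rotations of
    each other. *)
Lemma partition_class_IIE (Q D : nat) (R : realType) (n : nat) (A : 'M[R]_n)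
    (z : seq nat) : (0 < Q)%N -> (0 < D)%N -> typeII_form Q D A z ->
  partition_class_II Q D A = cyclic_rotations z.
Proof.
move=> Q0 D0 zA; have [_ szz zQ iso] := zA.
apply/seteqP; split => s.
  move=> [z' [_ szz' zQ' iso'] [k _ <-]].
  have [t ->] : exists t, z' = rot t z.
    apply: (typeII_iso_rot Q0 _ _ zQ' zQ); first by rewrite szz'.
      by rewrite szz szz'.
    exact: (digraph_iso_trans (digraph_iso_sym iso') iso).
  by have [m ->] := rot_rotE z k t; exists m.
by move=> zs; exists z.
Qed.

Lemma typeII_form_power (c q : nat) (R : realType) (n : nat) (B : 'M[R]_n)
    (zs : seq nat) :
  (0 < c)%N -> (0 < q)%N -> (0 < size zs)%N -> (sumn zs <= q - 1)%N ->
  coprime c (sumn zs) -> typeII_form (c * q) (size zs) B zs ->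
  typeII_form q (c * size zs) (B ^+ c) (power_parts c zs).
Proof.
move=> c0 q0 D0 zq cop [stB _ _ [f bf fe]]; split.
- exact: stochastic_exp.
- by rewrite size_mkseq.
- by rewrite sumn_power_parts.
have B0 i j : 0 <= B i j by case: stB => + _; apply.
have iso1 : digraph_iso (digraph_mx (B ^+ c)) (walk (@typeII_digraph (c * q) zs) c).
  exists f => // u v; have [_ ->] := digraph_expmx c u v B0.
  exact: walk_iso.
exact: (digraph_iso_trans iso1 (power_walk_typeII c0 q0 D0 zq cop)).
Qed.

(** * The parts and the successor map of the theorem *)

Lemma angle_mod_divz (c : nat) (k : int) : (0 < c)%N ->
  [/\ (1 <= angle_mod k c)%N, (angle_mod k c <= c)%N &
      k = ((k - (angle_mod k c)%:Z) %/ c)%Z * c%:Z + (angle_mod k c)%:Z].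
Proof.
move=> c0; have cZ : c%:Z != 0 by rewrite -lt0n.
have r0 := modz_ge0 (k - 1) cZ; have := ltz_mod (k - 1) cZ.
have rE : (`|((k - 1) %% c)%Z|)%N%:Z = ((k - 1) %% c)%Z by rewrite gez0_abs.
have aE : (angle_mod k c)%:Z = ((k - 1) %% c)%Z + 1 by rewrite PoszD rE addrC.
move=> rc; split; first by rewrite /angle_mod.
  by rewrite -lez_nat aE; lia.
have dE := divz_eq (k - 1) c.
have -> : k - (angle_mod k c)%:Z = ((k - 1) %/ c)%Z * c%:Z by rewrite aE; lia.
by rewrite mulzK // aE; lia.
Qed.

(** Write x = w c + a with 1 <= a <= c. At j = r + 1 the test j <= beta says r + a < c, that is,
    adding a to the residue r causes no carry; otherwise the quotient grows by one. *)
Lemma z_part_power_part (c : nat) (zs : seq nat) (k : nat) : (0 < c)%N ->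
  z_part c zs ((k %% size zs).+1, (cyclic_psum zs k %% c).+1) =
  Posz (power_part c zs k).
Proof.
move=> c0; rewrite /z_part /w_part /beta_part /power_part /part_hat /=.
set x := nth 0%N zs _; set r := (cyclic_psum zs k %% c)%N.
have rc : (r < c)%N by rewrite ltn_mod.
have [a1 ac] := angle_mod_divz x%:Z c0.
set a := angle_mod _ _ in a1 ac *; set w := (_ %/ c)%Z => xE.
rewrite -divz_nat PoszD xE addrCA divzMDl; last by rewrite -lt0n.
case: ifP => h; first by rewrite divz_small ?addr0 //; apply/andP; lia.
congr (w + _); have -> : r%:Z + a%:Z = 1 * c%:Z + (r%:Z + a%:Z - c%:Z) by lia.
rewrite divzMDl; last by rewrite -lt0n.
by rewrite divz_small ?addr0 //; apply/andP; lia.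
Qed.

(** Since beta = c - a is congruent to -x modulo c, subtracting it from j advances the residue by
    x. *)
Lemma next_part_step (c : nat) (zs : seq nat) (k : nat) : (0 < c)%N ->
  (0 < size zs)%N ->
  next_part c (size zs) zs ((k %% size zs).+1, (cyclic_psum zs k %% c).+1) =
  ((k.+1 %% size zs).+1, (cyclic_psum zs k.+1 %% c).+1).
Proof.
move=> c0 D0; rewrite /next_part /beta_part /part_hat /=; congr pair.
  rewrite -PoszD addn1 angle_modE //.
  by rewrite -[(k %% _).+1]addn1 modnDml addn1.
set x := nth 0%N zs _; set r := (cyclic_psum zs k %% c)%N.
have [a1 ac] := angle_mod_divz x%:Z c0.
set a := angle_mod _ _ in a1 ac *; set w := (_ %/ c)%Z => xE.
rewrite {1}/angle_mod add1n; congr S.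
rewrite cyclic_psumS -/x -modnDml -/r.
have -> : r.+1%:Z - (c%:Z - a%:Z) - 1 = (- w - 1) * c%:Z + (r + x)%N%:Z.
  by rewrite PoszD [in RHS]xE -addn1 PoszD; lia.
by rewrite modzMDl modz_nat absz_nat.
Qed.

Lemma traject_next_part (c : nat) (zs : seq nat) (m : nat) : (0 < c)%N ->
  (0 < size zs)%N ->
  traject (next_part c (size zs) zs) (1%N, 1%N) m =
  mkseq (fun k => ((k %% size zs).+1, (cyclic_psum zs k %% c).+1)) m.
Proof.
move=> c0 D0; have it k : iter k (next_part c (size zs) zs) (1%N, 1%N) =
    ((k %% size zs).+1, (cyclic_psum zs k %% c).+1).
  elim: k => [|k IH]; first by rewrite /cyclic_psum big_ord0 !mod0n.
  by rewrite iterS IH next_part_step.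
elim: m => [|m IH]; first by [].
by rewrite trajectSr IH it mkseqS.
Qed.

Lemma fcycle_traject (T : eqType) (f : T -> T) (x : T) (m : nat) :
  iter m f x = x -> fcycle f (traject f x m).
Proof.
case: m => [//|m] mE; rewrite trajectS [cycle _ _]/=.
have -> : rcons (traject f (f x) m) x = traject f (f x) m.+1.
  by rewrite trajectSr -iterSr mE.
exact: fpath_traject.
Qed.

(** By [cyclic_psum_inj] the first [c * size zs] pairs in the orbit of (1, 1) are distinct. This is
    the number of index pairs, so the orbit exhausts them. *)
Lemma single_cycle_next_part (c : nat) (zs : seq nat) : (0 < c)%N ->
  (0 < size zs)%N -> coprime c (sumn zs) ->
  single_cycle (part_indices c (size zs)) (next_part c (size zs) zs).
Proof.
move=> c0 D0 cop.
exists (traject (next_part c (size zs) zs) (1%N, 1%N) (c * size zs)).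
  have uT : uniq (traject (next_part c (size zs) zs) (1%N, 1%N) (c * size zs)).
    rewrite traject_next_part //; apply/mkseq_uniqP => k k' kc kc' [kD kp].
    exact: (cyclic_psum_inj c0 cop).
  have sT : {subset traject (next_part c (size zs) zs) (1%N, 1%N) (c * size zs)
      <= part_indices c (size zs)}.
    move=> ij; rewrite traject_next_part // => /mapP[k _ ->].
    by apply: allpairs_f; rewrite mem_iota /= add1n !ltnS ltn_mod.
  have szP : size (part_indices c (size zs)) = (c * size zs)%N.
    by rewrite size_allpairs !size_iota mulnC.
  have [eqT uP] := uniq_min_size uT sT (eq_leq (etrans szP (esym (size_traject _ _ _)))).
  by rewrite uniq_perm // /part_indices allpairs_uniq ?iota_uniq // => -[? ?] [? ?].
apply: fcycle_traject.
have := trajectSr (next_part c (size zs) zs) (1%N, 1%N) (c * size zs).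
rewrite !traject_next_part // mkseqS => /rcons_inj[<-].
rewrite modnMl -[X in cyclic_psum zs X]addn0 cyclic_psumMD /cyclic_psum.
by rewrite big_ord0 addn0 modnMr.
Qed.

Lemma consists_of_power_parts (c q : nat) (R : realType) (n : nat)
    (B : 'M[R]_n) (zs : seq nat) :
  (0 < c)%N -> (0 < q)%N -> (0 < size zs)%N -> (sumn zs <= q - 1)%N ->
  coprime c (sumn zs) -> typeII_form (c * q) (size zs) B zs ->
  consists_of_parts
    [set map Posz s | s in partition_class_II q (c * size zs) (B ^+ c)]
    (part_indices c (size zs)) (z_part c zs) (next_part c (size zs) zs).
Proof.
move=> c0 q0 D0 zq cop zB; split; first exact: single_cycle_next_part.
exists (1%N, 1%N); first by apply: allpairs_f; rewrite mem_iota.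
rewrite size_allpairs !size_iota [(size zs * c)%N]mulnC traject_next_part //.
rewrite (partition_class_IIE _ _ (typeII_form_power c0 q0 D0 zq cop zB)) ?muln_gt0 ?c0 //.
have -> : [seq z_part c zs k | k <- mkseq
    (fun k => ((k %% size zs).+1, (cyclic_psum zs k %% c).+1)) (c * size zs)] =
    map Posz (power_parts c zs).
  by rewrite -!map_comp; apply: eq_map => k /=; exact: z_part_power_part.
apply/seteqP; split => s.
  by move=> [_ [k _ <-] <-]; exists k; rewrite // map_rot.
by move=> [k _ <-]; exists (rot k (power_parts c zs)); rewrite ?map_rot //; exists k.
Qed.

(** * Stochastic matrices and their eigenvalues *)

(** The quotient g of the two sides has derivative [- (1 + T ^+ 2) * (expR (- T * y) * sin y)], so
    on [-pi, pi] it rises up to 0 and falls afterwards, with maximum g(0) = 1. *)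
Lemma tangent_cos_sin_le_expR (R : realType) (T x : R) : - pi <= x <= pi ->
  cos x + T * sin x <= expR (T * x).
Proof.
move=> /andP[xl xu].
pose g (y : R) := expR (- T * y) * (cos y + T * sin y).
pose dg (y : R) := - (1 + T ^+ 2) * (expR (- T * y) * sin y).
have gd (y : R) : is_derive y 1 g (dg y).
  rewrite /g /dg; apply: is_derive_eq.
  rewrite /GRing.scale /=; ring.
have gc (a b : R) : {within `[a, b], continuous g}.
  apply: derivable_within_continuous => y _; apply: ex_derive; exact: gd.
have g0 : g 0 = 1 by rewrite /g mulr0 expR0 cos0 sin0 mulr0 addr0 mulr1.
have dg_sgn (y : R) : sin y * dg y <= 0.
  rewrite /dg mulNr mulrN oppr_le0 mulrCA mulr_ge0 ?addr_ge0 ?sqr_ge0 //.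
  by rewrite mulrCA mulr_ge0 ?expR_ge0 // -expr2 sqr_ge0.
suff gx : g x <= 1.
  have e0 := expR_gt0 (T * x); rewrite -(mulr1 (expR _)).
  rewrite -ler_pdivrMl // -expRN -mulNr; exact: gx.
have [x0|x0] := leP 0 x.
  have [y yI yE] := MVT_segment x0 (fun y _ => gd y) (gc 0 x).
  move: yI; rewrite in_itv /= => /andP[y0 yx].
  suff dy : dg y <= 0 by move: yE; rewrite g0 subr0; nra.
  rewrite /dg mulNr oppr_le0 mulr_ge0 ?addr_ge0 ?sqr_ge0 //.
  by rewrite mulr_ge0 ?expR_ge0 // sin_ge0_pi // y0 (le_trans yx).
have [y yI yE] := MVT_segment (ltW x0) (fun y _ => gd y) (gc x 0).
move: yI; rewrite in_itv /= => /andP[xy y0].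
suff dy : 0 <= dg y by move: yE; rewrite g0 sub0r; nra.
rewrite /dg mulNr -mulrN mulr_ge0 ?addr_ge0 ?sqr_ge0 //.
rewrite -mulrN -sinN mulr_ge0 ?expR_ge0 // sin_ge0_pi //; lra.
Qed.

(** * Points of the unit circle *)

Definition cis (R : realType) (x : R) : R[i] := (cos x +i* sin x)%C.

Lemma cisD (R : realType) (x y : R) : cis (x + y) = cis x * cis y.
Proof. by rewrite /cis cosD sinD /GRing.mul /= [cos x * sin y + _]addrC. Qed.

Lemma cis0 (R : realType) : cis 0 = 1 :> R[i].
Proof. by rewrite /cis cos0 sin0. Qed.

Lemma cisN (R : realType) (x : R) : cis (- x) = conjc (cis x).
Proof. by rewrite /cis cosN sinN. Qed.

Lemma cisX (R : realType) (x : R) (k : nat) : cis x ^+ k = cis (k%:R * x).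
Proof.
elim: k => [|k IH]; first by rewrite expr0 mul0r cis0.
by rewrite exprS IH -cisD -[k.+1%:R]natr1 mulrDl mul1r addrC.
Qed.

Lemma cis_prod (R : realType) (D : nat) (x : 'I_D -> R) :
  \prod_i cis (x i) = cis (\sum_i x i).
Proof. by apply/esym/(big_morph _ (@cisD R) (cis0 R)). Qed.

Lemma cis_neq0 (R : realType) (x : R) : cis x != 0.
Proof.
rewrite eq_complex /=; apply/negP => /andP[/eqP c0 /eqP s0].
by have := cos2Dsin2 x; rewrite c0 s0 expr0n /= addr0 => /esym/eqP; rewrite oner_eq0.
Qed.

Lemma cis_2piz (R : realType) (k : int) : cis (2 * pi * k%:~R) = 1 :> R[i].
Proof.
have nat2pi (m : nat) : cis (2 * pi * m%:R) = 1 :> R[i].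
  rewrite mulrC -cisX [2 * pi]mulr_natl /cis cos2pi sin2pi.
  by rewrite -[(_ +i* _)%C]/(1 : R[i]) expr1n.
case: k => m; first exact: nat2pi.
by rewrite NegzE mulrN cisN nat2pi conjc1.
Qed.

(** Removing full turns leaves y in [0, 2 pi); then cos y = 1 - 2 sin(y/2)^2 makes sin(y/2) vanish,
    which forces y = 0. *)
Lemma cis_eq1 (R : realType) (x : R) : cis x = 1 :> R[i] ->
  exists k : int, x = 2 * pi * k%:~R.
Proof.
have pi0 : 0 < 2 * pi :> R by rewrite mulr_gt0 ?pi_gt0.
set k := Num.floor (x / (2 * pi)) => x1; exists k.
set y := x - 2 * pi * k%:~R.
have y1 : cis y = 1 by rewrite /y cisD x1 -mulrN -rmorphN cis_2piz mulr1.
have /andP[kx xk] : (k%:~R <= x / (2 * pi) < k%:~R + 1).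
  by have := Num.Theory.floor_itv (x / (2 * pi)); rewrite intrD.
have y0 : 0 <= y by move: kx; rewrite /y ler_pdivlMr //; lra.
have y2 : y < 2 * pi by move: xk; rewrite /y ltr_pdivrMr //; lra.
have s0 : sin (y / 2) = 0.
  have : cos (y / 2 *+ 2) = 1.
    have -> : y / 2 *+ 2 = y by rewrite mulr2n; lra.
    by case: y1.
  rewrite cos_mulr2n cos2sin2 => s1.
  by apply/eqP; rewrite -sqrf_eq0; apply/eqP; move: s1; rewrite mulr2n; lra.
suff : y = 0 by rewrite /y; lra.
apply/eqP; rewrite eq_le y0 andbT leNgt; apply/negP => ypos.
have : 0 < sin (y / 2) by apply: sin_gt0_pi; lra.
by rewrite s0 ltxx.
Qed.

(** * Eigenvectors and the set of stochastic eigenvalues *)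

Lemma eigenvalue_trmx (F : fieldType) (n : nat) (A : 'M[F]_n) (a : F) :
  eigenvalue A^T a = eigenvalue A a.
Proof.
rewrite !eigenvalue_root_char; congr (root _ a).
rewrite /char_poly -det_tr; congr (\det _); apply/matrixP => i j.
by rewrite !mxE eq_sym.
Qed.

(** [eigenvalue] speaks of row vectors; for a column vector the equation at u involves only the
    out-neighbours of u. *)
Lemma complex_eigenvalue_rightP (R : realType) (n : nat) (A : 'M[R]_n)
    (lambda : R[i]) :
  complex_eigenvalue A lambda <->
  exists2 x : 'I_n -> R[i], exists u, x u != 0 &
    forall u, lambda * x u = \sum_v (A u v)%:C%C * x v.
Proof.
rewrite /complex_eigenvalue -eigenvalue_trmx; split.
  move=> /eigenvalueP[v vE v0]; exists (fun u => v 0 u).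
    apply/existsP; rewrite -negb_forall; apply: contra v0 => /forallP v0.
    by apply/eqP/rowP => u; rewrite mxE; apply/eqP.
  move=> u; have := congr1 (fun w : 'rV_n => w 0 u) vE; rewrite !mxE => <-.
  by apply: eq_bigr => w _; rewrite !mxE mulrC.
move=> [x [u xu] xE]; apply/eigenvalueP; exists (\row_j x j).
  apply/rowP => w; rewrite !mxE xE; apply: eq_bigr => v _.
  by rewrite !mxE mulrC.
by apply: contra xu => /eqP/rowP/(_ u); rewrite !mxE => ->.
Qed.

Lemma complex_eigenvalue_conj (R : realType) (n : nat) (A : 'M[R]_n)
    (lambda : R[i]) :
  complex_eigenvalue A lambda -> complex_eigenvalue A (conjc lambda).
Proof.
move=> /complex_eigenvalue_rightP[x [u xu] xE].
apply/complex_eigenvalue_rightP; exists (fun v => conjc (x v)).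
  by exists u; rewrite conjc_eq0.
move=> v; rewrite -rmorphM xE rmorph_sum; apply: eq_bigr => w _.
by rewrite rmorphM; congr (_ * _); exact: conjc_real.
Qed.

(* A left eigenvector for an eigenvalue other than 1 has entries summing to 0,
   so it is annihilated by every matrix with constant columns. *)
Lemma Theta_star_shaped (R : realType) (n : nat) (lambda : R[i]) (t : R) :
  Theta n lambda -> lambda != 1 -> 0 <= t <= 1 -> Theta n (t%:C%C * lambda).
Proof.
move=> [A [A0 A1] /eigenvalueP[y yE ynz]] l1 /andP[t0 t1].
have n0 : (0 < n)%N.
  by case: n A A0 A1 y yE ynz => // A A0 A1 y yE; rewrite thinmx0 eqxx.
pose o : 'I_n := Ordinal n0.
pose A' : 'M[R]_n := \matrix_(i, j) (t * A i j + (1 - t) * (j == o)%:R).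
have y1 : \sum_i y 0 i = 0.
  apply/eqP; have : \sum_j (y *m map_mx (real_complex R) A) 0 j = lambda * \sum_i y 0 i.
    by rewrite yE mulr_sumr; apply: eq_bigr => j _; rewrite mxE.
  under eq_bigr do rewrite mxE.
  rewrite exchange_big /=; under eq_bigr => i _.
    rewrite -mulr_sumr; under eq_bigr do rewrite mxE.
    rewrite -rmorph_sum A1 rmorph1 mulr1; over.
  move=> /eqP; rewrite -[X in X == _]mul1r -subr_eq0 -mulrBl mulf_eq0 subr_eq0.
  by rewrite eq_sym (negPf l1).
exists A'.
  split=> [i j|i]; first by rewrite mxE addr_ge0 ?mulr_ge0 ?ler0n ?subr_ge0.
  under eq_bigr do rewrite mxE.
  rewrite big_split -!mulr_sumr A1 (bigD1 o) // eqxx big1 => [|j /negPf->//].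
  by rewrite /= addr0 !mulr1 addrC subrK.
apply/eigenvalueP; exists y => //; apply/rowP => j.
have := congr1 (fun w : 'rV_n => w 0 j) yE; rewrite !mxE -mulrA => <-.
rewrite mulr_sumr; under eq_bigr => i _.
  rewrite !mxE rmorphD !rmorphM /= mulrDr mulrCA; over.
rewrite big_split /= -[X in _ + X]mulr_suml y1 mul0r addr0.
by apply: eq_bigr => i _; rewrite mxE.
Qed.

Lemma stochastic_two_succ (R : realType) (n : nat) (A : 'M[R]_n)
    (u s s' : 'I_n) (x : 'I_n -> R[i]) : stochastic A ->
  (forall v, (A u v != 0) = (v == s) || (v == s')) ->
  exists a : R, 0 < a < 1 /\
    \sum_v (A u v)%:C%C * x v = a%:C%C * x s + (1 - a)%:C%C * x s'.
Proof.
move=> [A0 A1] supp; have := A1 u.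
have A_eq0 v : v != s -> v != s' -> A u v = 0.
  by move=> vs vs'; apply/eqP; rewrite -[_ == _]negbK supp negb_or vs vs'.
have [ss'|ss'] := eqVneq s s'.
  rewrite (bigD1 s) //= big1 ?addr0 => [Aus|v vs]; last by rewrite A_eq0 // -ss'.
  (* With coinciding successors any weight strictly between 0 and 1 serves. *)
  exists 2^-1; split; first by lra.
  rewrite (bigD1 s) //= big1 ?addr0 => [|v vs]; last by rewrite A_eq0 -?ss' // mul0r.
  by rewrite Aus -ss' -mulrDl -rmorphD addrC subrK.
rewrite (bigD1 s) //= (bigD1 s') 1?eq_sym //= big1 ?addr0; last first.
  by move=> v /andP[vs vs']; rewrite A_eq0.
move=> Aus.
have as0 : 0 < A u s by rewrite lt0r A0 supp eqxx.
have as0' : 0 < A u s' by rewrite lt0r A0 supp eqxx orbT.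
exists (A u s); split; first by lra.
rewrite (bigD1 s) //= (bigD1 s') 1?eq_sym //= big1 ?addr0.
  by congr (_ + _%:C%C * _); lra.
by move=> v /andP[vs vs']; rewrite A_eq0 // mul0r.
Qed.

(** Following the eigenvector through block i relates its entries X_i at first vertices: (lambda^Q -
    a_i) X_i = (1 - a_i) lambda^(z_i) X_(i+1). Multiplying over all blocks and cancelling the
    nonzero entries gives the claim. *)
Lemma typeII_eigenvalue_prod (R : realType) (Q D n : nat) (A : 'M[R]_n)
    (zs : seq nat) (lambda : R[i]) :
  (0 < Q)%N -> (0 < D)%N -> typeII_form Q D A zs ->
  complex_eigenvalue A lambda -> lambda != 0 ->
  (forall a : R, 0 < a -> lambda ^+ Q != a%:C%C) ->
  exists a : 'I_D -> R, (forall i, 0 < a i < 1) /\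
    \prod_i (lambda ^+ Q - (a i)%:C%C) =
    (\prod_i (1 - a i))%:C%C * lambda ^+ sumn zs.
Proof.
move=> Q0 D0 [stA szz zQ [f [g fK gK] fe]] /complex_eigenvalue_rightP[x [u0 xu0] xE] l0 lQ.
subst D.
pose X m := oapp (fun w : 'I_(Q * size zs) => x (g w)) 0 (insub m).
have XE (m : nat) (mN : (m < Q * size zs)%N) : X m = x (g (Ordinal mN)).
  by rewrite /X insubT.
have zi j : (nth 0 zs j <= Q.-1)%N by rewrite -subn1 (leq_trans (nth_leq_sumn zs j)).
have lt0 i : (i < size zs)%N -> (i * Q < Q * size zs)%N.
  by move=> iD; rewrite -[(i * Q)%N]addn0 ltn_MDsmall.
have iS i : (i.+1 %% size zs < size zs)%N by rewrite ltn_mod.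
have supp (i r : nat) (iD : (i < size zs)%N) (rQ : (r < Q)%N) (w : 'I_n) :
    (A (g (Ordinal (ltn_MDsmall iD rQ))) w != 0) =
    block_edge Q (size zs) (nth 0%N zs) (i * Q + r) (f w).
  by rewrite -typeII_edgeE ?ltn_MDsmall //; have := fe (g (Ordinal (ltn_MDsmall iD rQ))) w; rewrite gK.
have gE (w : 'I_n) (m : nat) (mN : (m < Q * size zs)%N) :
    (val (f w) == m) = (w == g (Ordinal mN)).
  by apply/eqP/eqP => [E|->]; [rewrite -[w]fK; congr g; exact: val_inj|rewrite gK].
have X1 i r : (i < size zs)%N -> (r < Q)%N -> (r + nth 0 zs i)%N != Q.-1 ->
    lambda * X (i * Q + r)%N = X (i * Q + r.+1 %% Q)%N.
  move=> iD rQ rz; have r1Q := ltn_pmod r.+1 Q0.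
  rewrite (XE _ (ltn_MDsmall iD rQ)) xE (XE _ (ltn_MDsmall iD r1Q)).
  set w := g (Ordinal (ltn_MDsmall iD r1Q)).
  have [|a [_ ->]] := @stochastic_two_succ _ _ A (g (Ordinal (ltn_MDsmall iD rQ))) w w x stA.
    by move=> v; rewrite orbb supp block_edgeE // (negPf rz) orbF; exact: gE.
  by rewrite -mulrDl -rmorphD addrC subrK mul1r.
have X2 i : (i < size zs)%N -> exists a : R, 0 < a < 1 /\
    lambda * X (i * Q + (Q.-1 - nth 0 zs i))%N =
    a%:C%C * X (i * Q + (Q.-1 - nth 0 zs i).+1 %% Q)%N +
    (1 - a)%:C%C * X (i.+1 %% size zs * Q)%N.
  move=> iD; have zi' := zi i; have rQ : (Q.-1 - nth 0 zs i < Q)%N by lia.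
  have r1Q := ltn_pmod (Q.-1 - nth 0%N zs i).+1 Q0.
  rewrite (XE _ (ltn_MDsmall iD rQ)) xE (XE _ (ltn_MDsmall iD r1Q)) (XE _ (lt0 _ (iS i))).
  apply: stochastic_two_succ => // v.
  by rewrite supp block_edgeE // subnK // eqxx; congr (_ || _); exact: gE.
have Xlow i k : (i < size zs)%N -> (k + nth 0 zs i <= Q.-1)%N ->
    X (i * Q + k)%N = lambda ^+ k * X (i * Q)%N.
  move=> iD; elim: k => [|k IH] kz; first by rewrite addn0 expr0 mul1r.
  have kQ : (k.+1 < Q)%N by move: (zi i); lia.
  rewrite exprS -mulrA -IH; last by lia.
  by rewrite X1 ?modn_small //; [exact: ltnW|lia].
(* Position [(Q - k) %% Q] lies k steps before the return to the first vertex; for k = 0 it is that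
   vertex. *)
have Xhigh i k : (i < size zs)%N -> (k <= nth 0 zs i)%N ->
    lambda ^+ k * X (i * Q + (Q - k) %% Q)%N = X (i * Q)%N.
  move=> iD; elim: k => [|k IH] kz; first by rewrite subn0 modnn addn0 expr0 mul1r.
  have zi' := zi i.
  rewrite exprSr -mulrA [((Q - k.+1) %% Q)%N]modn_small; last by lia.
  rewrite X1 //; [|lia|lia]; have -> : (Q - k.+1).+1 = (Q - k)%N by lia.
  by apply: IH; lia.
have step i : (i < size zs)%N -> exists a : R, 0 < a < 1 /\
    (lambda ^+ Q - a%:C%C) * X (i * Q)%N =
    ((1 - a)%:C%C * lambda ^+ nth 0%N zs i) * X (i.+1 %% size zs * Q)%N.
  move=> iD; have [a [a01 aE]] := X2 i iD; exists a; split=> //.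
  have zi' := zi i.
  have := congr1 (fun y => lambda ^+ nth 0%N zs i * y) aE.
  have -> : ((Q.-1 - nth 0 zs i).+1 = Q - nth 0 zs i)%N by lia.
  rewrite mulrDr [_ * (a%:C%C * _)]mulrCA Xhigh // Xlow //; last by lia.
  rewrite !mulrA -exprSr -exprD => E.
  rewrite mulrBl [(1 - a)%:C%C * _]mulrC; apply/eqP; rewrite subr_eq addrC -E.
  by have -> : ((nth 0 zs i).+1 + (Q.-1 - nth 0 zs i) = Q)%N by lia.
have [a aP] := choice (fun i : 'I_(size zs) => step i (ltn_ord i)).
exists a; split; first by move=> i; have [] := aP i.
(* A zero entry at a first vertex passes back to the preceding block because lambda^Q avoids a_i,
   hence round the cycle to the whole vector. *)
have Xnz i : (i < size zs)%N -> X (i * Q)%N != 0.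
  move=> iD; apply/eqP => Xi0.
  have Xback j : (j < size zs)%N -> X (j.+1 %% size zs * Q)%N = 0 -> X (j * Q)%N = 0.
    move=> jD Xj; have [a01 E] := aP (Ordinal jD); move: E; rewrite /= Xj mulr0 => /eqP.
    rewrite mulf_eq0 => /orP[|/eqP//]; rewrite subr_eq0 => /negPn; case/negP.
    by apply: lQ; case/andP: a01.
  have Xall k : (k <= i)%N -> X ((i - k) * Q)%N = 0.
    elim: k => [|k IH] ki; first by rewrite subn0.
    apply: Xback; first by lia.
    have -> : (i - k.+1).+1 = (i - k)%N by lia.
    by rewrite modn_small ?IH //; lia.
  have X00 : X (0 * Q)%N = 0 by have := Xall i (leqnn i); rewrite subnn.
  have Xall' k : (k < size zs)%N -> X ((size zs - k.+1) * Q)%N = 0.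
    elim: k => [|k IH] ki; apply: Xback; try lia.
      by rewrite subn1 prednK // modnn.
    have -> : (size zs - k.+2).+1 = (size zs - k.+1)%N by lia.
    by rewrite modn_small ?IH //; lia.
  have X0 j : (j < size zs)%N -> X (j * Q)%N = 0.
    move=> jD; have := Xall' (size zs - j.+1)%N.
    have -> : (size zs - (size zs - j.+1).+1 = j)%N by lia.
    by apply; lia.
  move/eqP: xu0; apply; rewrite -[u0]fK.
  have [j [r [jD rQ fE]]] := blockP (ltn_ord (f u0)).
  have -> : f u0 = Ordinal (ltn_MDsmall jD rQ) by exact: val_inj.
  rewrite -XE; have [le|gt] := leqP (r + nth 0%N zs j) Q.-1.
    by rewrite Xlow // X0 // mulr0.
  have := Xhigh j (Q - r)%N jD; rewrite X0 //.
  have rz : (Q - r <= nth 0 zs j)%N by lia.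
  move=> /(_ rz); have rE : (Q - (Q - r) = r)%N by lia.
  rewrite rE modn_small // => /eqP; rewrite mulf_eq0 expf_eq0 (negPf l0) andbF /=.
  by move/eqP.
pose Y (i : 'I_(size zs)) := X (i * Q)%N.
have Ynz : \prod_i Y i != 0 by apply/prodf_neq0 => i _; exact: Xnz.
apply: (mulIf Ynz); rewrite -big_split /=.
under eq_bigr => i _ do rewrite (aP i).2.
rewrite !big_split /=.
have -> : \prod_(i < size zs) X (i.+1 %% size zs * Q)%N = \prod_i Y i.
  rewrite [RHS](reindex_onto (fun i : 'I_(size zs) => Ordinal (iS i))
    (fun i : 'I_(size zs) => Ordinal (ltn_pmod (i + (size zs).-1)%N D0))) /=.
    apply: eq_big => i //; rewrite -val_eqE /= modnDml -addn1 -addnA add1n prednK //.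
    by rewrite modnDr modn_small ?eqxx.
  move=> i _; apply: val_inj => /=.
  by rewrite -[(_ %% _).+1]addn1 modnDml -addnA addn1 prednK // modnDr modn_small.
congr (_ * _ * _); first by rewrite rmorph_prod.
rewrite -(big_morph _ (exprD lambda) (expr0 lambda)); congr (_ ^+ _).
by rewrite sumnE (big_nth 0%N) big_mkord.
Qed.

(* The vector (lambda^r omega^i), indexed by the r-th vertex of block i, is an
   eigenvector: the last vertex of block i is sent to the first vertices of the
   blocks i and i + 1, the latter being replaced by vertex z of block 0 when
   i = D - 1. *)
Lemma Theta_block (R : realType) (Q D z : nat) (lambda omega : R[i]) (a : R) :
  (0 < D)%N -> (z < Q)%N -> 0 <= a <= 1 ->
  omega ^+ D = lambda ^+ z ->
  lambda ^+ Q = a%:C%C + (1 - a)%:C%C * omega ->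
  Theta (Q * D) lambda.
Proof.
move=> D0 zQ /andP[a0 a1] wD lQ; have Q0 : (0 < Q)%N by exact: leq_ltn_trans zQ.
pose succ (b : bool) (u : nat) : nat :=
  if ((u %% Q).+1 < Q)%N then u.+1 else
  if b then (u %/ Q * Q)%N else
  if ((u %/ Q).+1 < D)%N then ((u %/ Q).+1 * Q)%N else z.
have succN b (u : nat) : (u < Q * D)%N -> (succ b u < Q * D)%N.
  move=> /blockP[i [r [iD rQ ->]]]; rewrite /succ divnMDsmall // modnMDsmall //.
  case: ifP => [rQ'|_]; first by rewrite -addnS ltn_MDsmall.
  case: b; first by rewrite -[(i * Q)%N]addn0 ltn_MDsmall.
  case: ifP => [iD'|_]; first by rewrite -[(i.+1 * Q)%N]addn0 ltn_MDsmall.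
  by rewrite (leq_trans zQ) // leq_pmulr.
pose s b (u : 'I_(Q * D)) : 'I_(Q * D) := Ordinal (succN b u (ltn_ord u)).
pose A : 'M[R]_(Q * D) := \matrix_(u, v) (a * (v == s true u)%:R + (1 - a) * (v == s false u)%:R).
pose x (u : nat) : R[i] := lambda ^+ (u %% Q) * omega ^+ (u %/ Q).
have sum1 (K : pzRingType) (w : 'I_(Q * D)) (F : 'I_(Q * D) -> K) :
    \sum_v (v == w)%:R * F v = F w.
  rewrite (bigD1 w) // eqxx mul1r big1 /= ?addr0 // => v /negPf ->.
  by rewrite mul0r.
exists A.
  split=> [u v|u]; first by rewrite mxE addr_ge0 ?mulr_ge0 ?ler0n ?subr_ge0.
  under eq_bigr => v _ do rewrite mxE -[(v == s true u)%:R]mulr1 -[(v == s false u)%:R]mulr1.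
  by rewrite big_split /= -!mulr_sumr !(sum1 _ _ (fun=> 1)) !mulr1 addrC subrK.
apply/complex_eigenvalue_rightP; exists (fun u => x u).
  have n0 : (0 < Q * D)%N by rewrite muln_gt0 Q0.
  by exists (Ordinal n0); rewrite /x /= mod0n div0n !expr0 mulr1 oner_neq0.
move=> u.
have -> : \sum_v (A u v)%:C%C * x v = a%:C%C * x (s true u) + (1 - a)%:C%C * x (s false u).
  rewrite -(sum1 _ (s true u) (fun v => x v)) -(sum1 _ (s false u) (fun v => x v)).
  rewrite !mulr_sumr -big_split; apply: eq_bigr => v _ /=.
  by rewrite mxE rmorphD !rmorphM /= !rmorph_nat mulrDl !mulrA.
rewrite /= /x; have [i [r [iD rQ ->]]] := blockP (ltn_ord u).
rewrite /succ divnMDsmall // modnMDsmall //; case: ifP => [rQ'|rQ'].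
  rewrite -addnS divnMDsmall // modnMDsmall // mulrA -exprS.
  by rewrite -mulrDl -rmorphD addrC subrK mul1r.
have rE : r.+1 = Q by move/negbT: rQ'; rewrite -leqNgt => le; apply/eqP; rewrite eqn_leq rQ.
rewrite modnMl mulnK // expr0 mul1r mulrA -exprS rE lQ mulrDl -mulrA -exprS.
congr (_ + _ * _); case: ifP => [iD'|iD'].
  by rewrite modnMl mulnK // expr0 mul1r.
have iE : i.+1 = D by move/negbT: iD'; rewrite -leqNgt => le; apply/eqP; rewrite eqn_leq iD.
by rewrite iE wD modn_small // divn_small // expr0 mulr1.
Qed.

(** * The Karpelevic arc *)

Lemma real_complexX (R : realType) (x : R) (k : nat) :
  (x ^+ k)%:C%C = x%:C%C ^+ k :> R[i].
Proof. exact: rmorphXn. Qed.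

Lemma mul_real_complex (R : realType) (a x y : R) :
  a%:C%C * (x +i* y)%C = ((a * x) +i* (a * y))%C.
Proof. by rewrite {1}/GRing.mul /= !mul0r subr0 addr0. Qed.

(* If s e^(i phi) - a = r e^(i (phi + x)) with r > 0, then
   sine_gap phi x s * r = s (1 - a) sin phi. *)
Local Notation sine_gap phi x s := (sin (phi + x) - s * sin x).

(** For s = 1 the gap is 2 cos(kappa + phi/2) sin(phi/2), and lowering s only raises it. *)
Lemma slack_gt0 (R : realType) (phi kappa s : R) :
  0 < phi -> 0 < kappa -> phi + 2 * kappa < pi -> s <= 1 ->
  0 < sine_gap phi kappa s.
Proof.
move=> p0 k0 pk s1; have sk : 0 < sin kappa by apply: sin_gt0_pi; lra.
have : 0 < cos (kappa + phi / 2) by apply: cos_gt0_pihalf; lra.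
have : 0 < sin (phi / 2) by apply: sin_gt0_pi; lra.
have : sine_gap phi kappa 1 = 2 * cos (kappa + phi / 2) * sin (phi / 2).
  have -> : phi + kappa = (kappa + phi / 2) + phi / 2 by lra.
  have {2}-> : kappa = (kappa + phi / 2) - phi / 2 by lra.
  by rewrite sinD sinB; lra.
by nra.
Qed.

(* By the intermediate value theorem the inequality becomes an equality for
   some larger radius; star-shapedness gives back the original radius. *)
Lemma Theta_of_slack (R : realType) (Q D z : nat) (rho theta phi kappa : R) :
  (0 < D)%N -> (z < Q)%N -> 0 < rho <= 1 ->
  0 < phi -> 0 < kappa -> phi + 2 * kappa < pi ->
  cis (Q%:R * theta) = cis phi -> cis (D%:R * (phi + kappa)) = cis (z%:R * theta) ->
  rho ^+ (Q * D - z) * sin phi ^+ D <= sine_gap phi kappa (rho ^+ Q) ^+ D ->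
  Theta (Q * D) (rho%:C%C * cis theta).
Proof.
move=> D0 zQ /andP[r0 r1] p0 k0 pk cQ cD slack.
have sp : 0 < sin phi by apply: sin_gt0_pi; lra.
have sk : 0 < sin kappa by apply: sin_gt0_pi; lra.
have spk : 0 < sin (phi + kappa) by apply: sin_gt0_pi; lra.
pose p : {poly R} := 'X^(Q * D - z) * (sin phi ^+ D)%:P -
  ((sin (phi + kappa))%:P - 'X^Q * (sin kappa)%:P) ^+ D.
have pE x : p.[x] = x ^+ (Q * D - z) * sin phi ^+ D - sine_gap phi kappa (x ^+ Q) ^+ D.
  by rewrite /p !(hornerE, horner_exp, hornerXn).
(* At radius 1 the inequality is reversed, because sin(phi + kappa) - sin kappa <= sin phi. *)
have [rho' /andP[rr' r'1] /rootP] : exists2 x, rho <= x <= 1 & root p x.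
  apply: poly_ivt => //; rewrite !pE !expr1n mul1r subr_le0 slack /= subr_ge0.
  have ? := cos_le1 kappa; have ? := cos_le1 phi.
  have E1 := slack_gt0 p0 k0 pk (lexx 1).
  apply: lerXn2r; rewrite ?nnegrE ?(ltW E1) ?(ltW sp) //.
  by rewrite sinD; nra.
rewrite pE => /eqP; rewrite subr_eq0 => /eqP rE.
have r'0 : 0 < rho' by exact: lt_le_trans rr'.
set s := rho' ^+ Q in rE.
have s0 : 0 < s by rewrite exprn_gt0.
have s1 : s <= 1 by rewrite exprn_ile1 // ltW.
have E0 := slack_gt0 p0 k0 pk s1; set e := sine_gap phi kappa s in rE E0.
(* The line through s e^(i phi) in direction phi + kappa meets the real axis at a; the distance
   between these two points is (1 - a) g. Equality at the radius rho' says that g^D = rho'^z. *)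
pose a := s * sin kappa / sin (phi + kappa).
pose g := s * sin phi / e.
have lE : (rho'%:C%C * cis theta) ^+ Q = s%:C%C * cis phi.
  by rewrite exprMn cisX cQ -real_complexX.
have Th : Theta (Q * D) (rho'%:C%C * cis theta).
  apply: (@Theta_block _ _ _ z _ (g%:C%C * cis (phi + kappa)) a) => //.
  - rewrite /a divr_ge0 ?mulr_ge0 ?(ltW s0) ?(ltW sk) ?(ltW spk) //=.
    by rewrite ler_pdivrMr // mul1r; move: E0; rewrite /e; lra.
  - rewrite !exprMn !cisX cD -!real_complexX; congr (_%:C%C * _).
    rewrite /g expr_div_n exprMn -rE /s -exprM.
    have rn : rho' ^+ (Q * D - z) != 0 by rewrite expf_neq0 // gt_eqF.
    have pn : sin phi ^+ D != 0 by rewrite expf_neq0 // gt_eqF.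
    have zQD : (z <= Q * D)%N by rewrite (leq_trans (ltnW zQ)) // leq_pmulr.
    have -> : rho' ^+ (Q * D) = rho' ^+ (Q * D - z) * rho' ^+ z by rewrite -exprD subnK.
    by field; rewrite rn pn.
  - rewrite lE mulrA -rmorphM /= /cis !mul_real_complex.
    have gE : (1 - a) * g = s * sin phi / sin (phi + kappa).
      by rewrite /a /g /e; field; rewrite (gt_eqF spk) /= gt_eqF.
    rewrite gE -[a%:C%C]/(a +i* 0)%C {1}/GRing.add /= add0r.
    apply/eqP; rewrite eq_complex /=; apply/andP; split; apply/eqP; last first.
      by field; rewrite gt_eqF.
    apply: (mulfI (lt0r_neq0 spk)); rewrite /a mulrDr.
    have -> : sin (phi + kappa) * (s * sin kappa / sin (phi + kappa)) = s * sin kappa.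
      by field; rewrite gt_eqF.
    have -> : sin (phi + kappa) * (s * sin phi / sin (phi + kappa) * cos (phi + kappa)) =
        s * sin phi * cos (phi + kappa) by field; rewrite gt_eqF.
    have c2 := cos2Dsin2 phi; rewrite sinD cosD.
    have -> : s * sin kappa = s * sin kappa * (cos phi ^+ 2 + sin phi ^+ 2) by rewrite c2 mulr1.
    ring.
have -> : rho%:C%C * cis theta = (rho / rho')%:C%C * (rho'%:C%C * cis theta).
  by rewrite mulrA -rmorphM /= divfK // gt_eqF.
apply: Theta_star_shaped => //.
  apply/eqP => l1; move: lE; rewrite l1 expr1n /cis mul_real_complex => /(congr1 (@complex.Im R))/=.
  by move/esym/eqP; rewrite mulf_eq0 !gt_eqF.
by rewrite divr_ge0 ?(ltW r0) ?(ltW r'0) //= ler_pdivrMr // mul1r.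
Qed.

(* x |-> sine_gap phi x s solves y'' = - y, hence is log-concave: it lies below
   the exponential tangent to it at kappa. *)
Lemma slack_le_expR (R : realType) (phi kappa s x : R) :
  0 < sine_gap phi kappa s -> - pi <= x - kappa <= pi ->
  sine_gap phi x s <= sine_gap phi kappa s *
    expR ((cos (phi + kappa) - s * cos kappa) / sine_gap phi kappa s * (x - kappa)).
Proof.
move=> E0 xk; set e := sine_gap phi kappa s in E0 *; set e' := cos _ - _.
have -> : sine_gap phi x s = e * (cos (x - kappa) + e' / e * sin (x - kappa)).
  rewrite mulrDr mulrA [e * (e' / e)]mulrC divfK ?gt_eqF //.
  have {1}-> : phi + x = (phi + kappa) + (x - kappa) by lra.
  have {2}-> : x = kappa + (x - kappa) by lra.
  by rewrite /e /e' sinD [sin (kappa + _)]sinD; ring.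
by rewrite ler_pM2l // tangent_cos_sin_le_expR.
Qed.

(** Take logarithms: l = ln rho < 0 and L = ln(e / sin phi). The tangent at kappa, evaluated at all
    eta_i, bounds m l; evaluated at 0, it gives T kappa <= L. As the sum H of the eta_i exceeds D
    kappa, kappa m l <= H L follows, and the hypothesis on m and m0 turns this into m0 l < D L. *)
Lemma slack_of_root (R : realType) (D m m0 : nat) (rho s phi kappa : R)
    (eta : 'I_D -> R) :
  0 < rho < 1 -> 0 < phi -> 0 < kappa -> phi + 2 * kappa < pi -> s <= 1 ->
  (forall i, 0 < eta i < pi) -> (forall i, 0 < sine_gap phi (eta i) s) ->
  \prod_i sine_gap phi (eta i) s = rho ^+ m * sin phi ^+ D ->
  D%:R * kappa < \sum_i eta i ->
  m%:R * (D%:R * kappa) < m0%:R * \sum_i eta i ->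
  rho ^+ m0 * sin phi ^+ D < sine_gap phi kappa s ^+ D.
Proof.
move=> /andP[r0 r1] p0 k0 pk s1 eta0 Eeta prodE; set H := \sum_i eta i => kH mH.
have sp : 0 < sin phi by apply: sin_gt0_pi; lra.
have E0 := slack_gt0 p0 k0 pk s1.
have E_le x := @slack_le_expR _ phi kappa s x E0.
set T := _ / _ in E_le; set e := sine_gap phi kappa s in E0 E_le *.
set l := ln rho; have rE : rho = expR l by rewrite lnK ?posrE.
have l0 : l < 0 by rewrite ln_lt0 // r0.
set L := ln (e / sin phi).
have eE : e = sin phi * expR L by rewrite lnK ?posrE ?divr_gt0 // mulrC divfK ?gt_eqF.
have TL : T * kappa <= L.
  have k1 : - pi <= 0 - kappa <= pi by lra.
  have := E_le 0 k1; rewrite addr0 sin0 mulr0 subr0 sub0r eE mulrN -mulrA -expRD.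
  by rewrite -[X in X <= _]mulr1 ler_pM2l // -expR0 ler_expR; lra.
have prod_le : m%:R * l <= D%:R * L + T * (H - D%:R * kappa).
  have : rho ^+ m * sin phi ^+ D <= \prod_(i < D) (e * expR (T * (eta i - kappa))).
    rewrite -prodE; apply: ler_prod => i _; rewrite (ltW (Eeta i)) /=.
    by apply: E_le; have := eta0 i; lra.
  rewrite big_split /= prodr_const card_ord -expR_sum -mulr_sumr sumrB sumr_const card_ord.
  rewrite {1}eE exprMn [sin phi ^+ D * _]mulrC -mulrA [sin phi ^+ D * _]mulrC mulrA.
  rewrite ler_pM2r ?exprn_gt0 //.
  rewrite rE -!expRM_natl -expRD ler_expR -/H -[kappa *+ D]mulr_natl; lra.
have DL : m0%:R * l < D%:R * L.
  have D0 : 0 <= D%:R :> R by [].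
  have Hpos : 0 < H by nra.
  have h1 : kappa * (m%:R * l) <= H * L by nra.
  rewrite -(ltr_pM2l Hpos); nra.
rewrite eE exprMn [X in _ < X]mulrC ltr_pM2r ?exprn_gt0 //.
by rewrite rE -!expRM_natl ltr_expR.
Qed.

(** * From the eigenvalue equation to the slack inequality *)

Lemma cis_polar_inj (R : realType) (a b x y : R) : 0 < a -> 0 < b ->
  a%:C%C * cis x = b%:C%C * cis y -> a = b /\ cis (x - y) = 1.
Proof.
move=> a0 b0; rewrite /cis !mul_real_complex => -[Ec Es].
have ab : a = b.
  have : a ^+ 2 = b ^+ 2.
    rewrite -[a ^+ 2]mulr1 -[b ^+ 2]mulr1 -{1}(cos2Dsin2 x) -(cos2Dsin2 y).
    by rewrite !mulrDr -!exprMn Ec Es.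
  by move/eqP; rewrite eqrXn2 ?ltW // => /eqP.
split=> //; rewrite -/(cis _) cisD cisN.
have -> : cis x = cis y.
  have a_inj := mulfI (lt0r_neq0 a0); move: Ec Es; rewrite -ab => /a_inj Ec /a_inj Es.
  by rewrite /cis Ec Es.
have := cos2Dsin2 y; rewrite /cis /GRing.mul /= mulrN opprK -!expr2 => ->.
by rewrite mulrN mulrC addrC subrr.
Qed.

(** Subtracting a > 0 moves a point of the upper half plane to the left along a horizontal line, so
    its argument increases but stays below pi. *)
Lemma slack_arg (R : realType) (phi s a : R) :
  0 < phi < pi -> 0 < s -> 0 < a < 1 ->
  exists eta r : R, [/\ 0 < eta < pi, 0 < r,
    s%:C%C * cis phi - a%:C%C = r%:C%C * cis (phi + eta) &
    sine_gap phi eta s * r = s * (1 - a) * sin phi].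
Proof.
move=> /andP[p0 p1] s0 /andP[a0 a1].
have sp : 0 < sin phi by apply: sin_gt0_pi; rewrite p0.
set x := s * cos phi - a; set y := s * sin phi.
have y0 : 0 < y by rewrite mulr_gt0.
set r := Num.sqrt (x ^+ 2 + y ^+ 2).
have xy0 : 0 < x ^+ 2 + y ^+ 2 by rewrite ltr_wpDl ?sqr_ge0 ?exprn_gt0.
have r0 : 0 < r by rewrite sqrtr_gt0.
have r2 : r ^+ 2 = x ^+ 2 + y ^+ 2 by rewrite sqr_sqrtr // ltW.
have y1 : (y / r) ^+ 2 = 1 - (x / r) ^+ 2.
  by rewrite !expr_div_n r2; field; rewrite gt_eqF.
have y1' : 0 < y / r by rewrite divr_gt0.
have xr : -1 < x / r < 1 by nra.
have xr' : -1 <= x / r <= 1 by lra.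
set psi := acos (x / r).
have cpsi : cos psi = x / r by rewrite /psi acosK // in_itv /=.
have spsi : sin psi = y / r by rewrite /psi sin_acos // -y1 sqrtr_sqr gtr0_norm.
have psi0 : 0 < psi by apply: acos_gt0; lra.
have psi1 : psi < pi by apply: acos_ltpi; lra.
have seta : sin (psi - phi) = a * sin phi / r.
  rewrite sinB cpsi spsi /x /y; field; by rewrite gt_eqF.
exists (psi - phi), r; split=> //.
- rewrite andbC; apply/andP; split; first by lra.
  rewrite ltNge; apply/negP => le0.
  have : 0 <= sin (- (psi - phi)) by apply: sin_ge0_pi; lra.
  have := divr_gt0 (mulr_gt0 a0 sp) r0; rewrite sinN seta; lra.
- have -> : phi + (psi - phi) = psi by lra.
  rewrite /cis !mul_real_complex cpsi spsi ![r * _]mulrC !divfK ?gt_eqF //.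
  by rewrite -[a%:C%C]/(a +i* 0)%C /GRing.add /GRing.opp /= oppr0 addr0.
- have -> : phi + (psi - phi) = psi by lra.
  rewrite seta spsi /y; field; by rewrite gt_eqF.
Qed.

(** By unimodularity n - Z = x Q + y (n - z) with n = Q D, and the last hypothesis says y >= 1. If x
    >= 1, or if x = 0 and y >= 2, the right side exceeds n; if x = 0 and y = 1, then Z = z. So x <
    0, which is the claim. *)
Lemma unimodular_sector (Q D z Z : nat) (P P' N : int) :
  (0 < D)%N -> (2 * z < Q)%N -> (Z < Q)%N -> Z <> z ->
  P' * Q%:Z - P * (Q * D - z)%N%:Z = 1 ->
  (Q * D - Z)%N%:Z * P < N * Q%:Z ->
  (Q * D - Z)%N%:Z * P' < N * (Q * D - z)%N%:Z.
Proof.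
move=> D0 zQ ZQ Zz det NP.
have QDQ : (Q <= Q * D)%N by rewrite leq_pmulr.
move: det NP; move: (Q * D)%N QDQ => n Qn.
have m0E : (n - z)%N%:Z = n%:Z - z%:Z by lia.
have mE : (n - Z)%N%:Z = n%:Z - Z%:Z by lia.
rewrite m0E mE => det NP.
pose x : int := (n%:Z - Z%:Z) * P' - N * (n%:Z - z%:Z).
pose y : int := N * Q%:Z - (n%:Z - Z%:Z) * P.
have mxy : n%:Z - Z%:Z = x * Q%:Z + y * (n%:Z - z%:Z).
  by rewrite -[LHS]mulr1 -det /x /y; ring.
suff : x < 0 by rewrite /x; lia.
have y1 : 1 <= y by rewrite /y; lia.
clearbody x y; rewrite ltNge; apply/negP; rewrite le_eqVlt => /orP[/eqP x0|x0].
  have ym : n%:Z - Z%:Z = y * (n%:Z - z%:Z) by rewrite mxy -x0 mul0r add0r.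
  have [y2|y2] := leP 2 y; first by clear - Qn zQ ZQ ym y2; nia.
  have y1E : y = 1 by lia.
  by apply: Zz; move: ym; rewrite y1E mul1r; lia.
clear - Qn zQ ZQ mxy x0 y1; nia.
Qed.

(** The factors of the product have arguments phi + eta_i. Comparing moduli gives the product
    required by [slack_of_root]; comparing arguments gives the sum of the eta_i up to full turns,
    which [unimodular_sector] restricts. *)
Lemma root_slack (R : realType) (Q D z Z : nat) (P P' : int)
    (rho theta : R) (a : 'I_D -> R) :
  (0 < D)%N -> (4 <= Q)%N -> (3 <= Q * D - z)%N -> (2 * z < Q)%N -> (Z < Q)%N ->
  P' * Q%:Z - P * (Q * D - z)%N%:Z = 1 ->
  0 < rho -> (2 * pi) * P%:~R < Q%:R * theta ->
  (Q * D - z)%:R * theta < (2 * pi) * P'%:~R ->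
  (forall i, 0 < a i < 1) ->
  \prod_i ((rho%:C%C * cis theta) ^+ Q - (a i)%:C%C) =
    (\prod_i (1 - a i))%:C%C * (rho%:C%C * cis theta) ^+ Z ->
  let phi := Q%:R * theta - (2 * pi) * P%:~R in
  let kappa := ((2 * pi) * P'%:~R - (Q * D - z)%:R * theta) / D%:R in
  Z <> z ->
  rho < 1 /\
  rho ^+ (Q * D - z) * sin phi ^+ D < sine_gap phi kappa (rho ^+ Q) ^+ D.
Proof.
move=> D0 Q4 m03 zQ ZQ det rho0 tP tP' a01 prodE phi kappa Zz.
set m0 := (Q * D - z)%N in m03 det tP' kappa *.
set m := (Q * D - Z)%N.
have pi0 := pi_gt0 R.
have DR : 0 < D%:R :> R by rewrite ltr0n.
have p0 : 0 < phi by rewrite /phi; lra.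
have kE : D%:R * kappa = (2 * pi) * P'%:~R - m0%:R * theta.
  by rewrite /kappa mulrC divfK // gt_eqF.
have k0 : 0 < kappa by rewrite -(pmulr_rgt0 _ DR) kE; lra.
have detR : P'%:~R * Q%:R - P%:~R * m0%:R = 1 :> R.
  by have := congr1 (fun t : int => t%:~R : R) det; rewrite rmorphB !rmorphM.
have sumE : m0%:R * phi + (Q%:R * D%:R) * kappa = 2 * pi.
  have -> : 2 * pi = 2 * pi * (P'%:~R * Q%:R - P%:~R * m0%:R) :> R by rewrite detR mulr1.
  by rewrite -mulrA kE /phi; ring.
have m03R : 3 <= m0%:R :> R by rewrite (ler_nat _ 3).
have QD4R : 4 <= Q%:R * D%:R :> R by rewrite -natrM (ler_nat _ 4) (leq_trans Q4) // leq_pmulr.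
(* With m0 >= 3 and Q D >= 4 the identity confines phi and kappa enough for phi + 2 kappa < pi. *)
have bound : 3 * phi + 4 * kappa <= 2 * pi by rewrite -sumE; nra.
have phi_pi : 0 < phi < pi by rewrite p0 /=; lra.
have pk : phi + 2 * kappa < pi by lra.
have sp : 0 < sin phi by apply: sin_gt0_pi.
set s := rho ^+ Q; have s0 : 0 < s by rewrite exprn_gt0.
have lQ : (rho%:C%C * cis theta) ^+ Q = s%:C%C * cis phi.
  by rewrite exprMn cisX -real_complexX /phi cisD -mulrN -rmorphN cis_2piz mulr1.
have [eta etaP] := choice (fun i => slack_arg phi_pi s0 (a01 i)).
have [r rP] := choice etaP.
have eta0 i : 0 < eta i < pi by have [] := rP i.
have r0 i : 0 < r i by have [] := rP i.
have rE i : s%:C%C * cis phi - (a i)%:C%C = (r i)%:C%C * cis (phi + eta i).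
  by have [] := rP i.
have Er i : sine_gap phi (eta i) s * r i = s * (1 - a i) * sin phi by have [] := rP i.
have E0 i : 0 < sine_gap phi (eta i) s.
  rewrite -(pmulr_lgt0 _ (r0 i)) Er !mulr_gt0 //; by have := a01 i; lra.
have pr0 : 0 < \prod_i r i by apply: prodr_gt0.
have pa0 : 0 < \prod_i (1 - a i) by apply: prodr_gt0 => i _; have := a01 i; lra.
have [prodR argE] : \prod_i r i = \prod_i (1 - a i) * rho ^+ Z /\
    cis (\sum_i (phi + eta i) - Z%:R * theta) = 1.
  apply: cis_polar_inj; rewrite ?mulr_gt0 ?exprn_gt0 //.
  rewrite -cis_prod rmorph_prod /= -big_split /= [in RHS]rmorphM -mulrA /=.
  rewrite real_complexX -cisX -exprMn -prodE; apply: eq_bigr => i _.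
  by rewrite lQ rE.
have prodEE : \prod_i sine_gap phi (eta i) s = rho ^+ m * sin phi ^+ D.
  apply: (mulIf (lt0r_neq0 pr0)); rewrite -big_split /=.
  under eq_bigr do rewrite Er.
  rewrite !big_split /= !prodr_const card_ord prodR /s -exprM.
  have -> : rho ^+ (Q * D) = rho ^+ m * rho ^+ Z.
    by rewrite -exprD subnK // (leq_trans (ltnW ZQ)) // leq_pmulr.
  ring.
(* For rho >= 1 every gap would be below sin phi, while their product would be at least
   [sin phi ^+ D]. *)
have rho1 : rho < 1.
  rewrite ltNge; apply/negP => rho1.
  have cp : cos phi < 1.
    by rewrite -(cos0 R) ltr_cos ?in_itv /= ?lexx ?(ltW p0) ?(ltW pi0) //; lra.
  have s1 : 1 <= s by rewrite exprn_ege1.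
  have Elt i : sine_gap phi (eta i) s < sin phi.
    have se : 0 < sin (eta i) by apply: sin_gt0_pi; exact: eta0.
    have ce := cos_le1 (eta i); rewrite sinD; nra.
  have : \prod_i sine_gap phi (eta i) s < \prod_(i < D) sin phi.
    apply: ltr_prod; last by move=> i _; rewrite (ltW (E0 i)) Elt.
    by apply/hasP; exists (Ordinal D0); rewrite ?mem_index_enum.
  rewrite prodEE prodr_const card_ord -[X in _ < X]mul1r ltr_pM2r ?exprn_gt0 //.
  by rewrite ltNge exprn_ege1.
split=> //.
have [k kE2] := cis_eq1 argE.
pose N := D%:Z * P + k.
have HE : \sum_i eta i = (2 * pi) * N%:~R - m%:R * theta.
  move: kE2; rewrite big_split /= sumr_const card_ord -mulr_natl.
  have -> : m%:R = Q%:R * D%:R - Z%:R :> R.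
    by rewrite /m natrB ?natrM // (leq_trans (ltnW ZQ)) // leq_pmulr.
  rewrite /N rmorphD rmorphM /= /phi -[D%:~R]/(D%:R); lra.
have H0 : 0 < \sum_i eta i.
  rewrite (bigD1 (Ordinal D0)) //= ltr_wpDr //.
    by apply: sumr_ge0 => i _; case/andP: (eta0 i) => /ltW.
  by case/andP: (eta0 (Ordinal D0)).
have mpos : 0 < m%:R :> R by rewrite ltr0n subn_gt0 (leq_trans ZQ) // leq_pmulr.
have QR : 0 < Q%:R :> R by rewrite ltr0n (leq_trans _ Q4).
have NP : m%:Z * P < N * Q%:Z.
  rewrite -(ltr_int R) !rmorphM /= -[Q%:~R]/(Q%:R) -[m%:~R]/(m%:R).
  rewrite -(ltr_pM2l pi0); nra.
have mP' := unimodular_sector D0 zQ ZQ Zz det NP.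
(* In these coordinates the sum of the eta_i is y D kappa - x phi with x <= -1 and y >= 1, hence
   exceeds D kappa. *)
pose x : int := m%:Z * P' - N * m0%:Z; pose y : int := N * Q%:Z - m%:Z * P.
have xR : x%:~R <= -1 :> R.
  have x1 : x <= -1 by move: mP'; rewrite -subr_lt0 -/m0 -/x; clear; lia.
  by rewrite -(ler_int R) in x1.
have yR : 1 <= y%:~R :> R.
  have y1 : 1 <= y by move: NP; rewrite -subr_gt0 -/y; clear; lia.
  by rewrite -(ler_int R) in y1.
have HE2 : \sum_i eta i = y%:~R * (D%:R * kappa) - x%:~R * phi.
  rewrite HE kE /phi /x /y !rmorphB !rmorphM /=.
  rewrite -[m%:~R]/(m%:R) -[Q%:~R]/(Q%:R) -[m0%:~R]/(m0%:R).
  have -> : 2 * pi * N%:~R - m%:R * theta =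
    (2 * pi * N%:~R - m%:R * theta) * (P'%:~R * Q%:R - P%:~R * m0%:R) :> R by rewrite detR mulr1.
  ring.
apply: slack_of_root prodEE _ _ => //.
- by rewrite rho0.
- by rewrite exprn_ile1 // ltW.
- by rewrite HE2 kE; nra.
- rewrite kE HE.
  have : m%:R * P'%:~R < m0%:R * N%:~R :> R.
    move: mP'; rewrite -(ltr_int R) !rmorphM /=.
    by rewrite -[(Q * D - Z)%N%:~R]/(m%:R) -[(Q * D - z)%N%:~R]/(m0%:R); lra.
  by nra.
Qed.

(** Radius and argument can be chosen continuously near rho e^(i theta), so the strict inequalities
    persist and [Theta_of_slack] applies to all nearby points. *)
Lemma Theta_near_slack (R : realType) (Q D z : nat) (P P' : int)
    (rho theta : R) :
  (0 < D)%N -> (z < Q)%N -> 0 < rho < 1 ->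
  P' * Q%:Z - P * (Q * D - z)%N%:Z = 1 ->
  let phi t := Q%:R * t - (2 * pi) * P%:~R in
  let kappa t := ((2 * pi) * P'%:~R - (Q * D - z)%:R * t) / D%:R in
  0 < phi theta -> 0 < kappa theta -> phi theta + 2 * kappa theta < pi ->
  rho ^+ (Q * D - z) * sin (phi theta) ^+ D <
    (sin (phi theta + kappa theta) - rho ^+ Q * sin (kappa theta)) ^+ D ->
  exists2 e : R, 0 < e & forall x y : R,
    `|rho * cos theta - x| < e -> `|rho * sin theta - y| < e ->
    Theta (Q * D) (x +i* y)%C.
Proof.
move=> D0 zQ /andP[r0 r1] det phi kappa p0 k0 pk slack.
have DR : D%:R != 0 :> R by rewrite pnatr_eq0 -lt0n.
have Theta_polar r t : 0 < r <= 1 -> 0 < phi t -> 0 < kappa t ->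
    phi t + 2 * kappa t < pi ->
    r ^+ (Q * D - z) * sin (phi t) ^+ D <
      (sin (phi t + kappa t) - r ^+ Q * sin (kappa t)) ^+ D ->
    Theta (Q * D) (r%:C%C * cis t).
  move=> r01 pt kt pkt /ltW; apply: Theta_of_slack => //.
    by rewrite /phi cisD -mulrN -rmorphN cis_2piz mulr1.
  have -> : D%:R * (phi t + kappa t) = z%:R * t + (2 * pi) * (P' - D%:Z * P)%:~R.
    have zn : (z <= Q * D)%N by rewrite (leq_trans (ltnW zQ)) // leq_pmulr.
    rewrite mulrDr /kappa [_ / _]mulrC [D%:R * (_ * _)]mulrA divff // mul1r /phi.
    rewrite natrB // natrM rmorphB rmorphM /= -[D%:~R]/(D%:R); ring.
  by rewrite cisD cis_2piz mulr1.
pose x0 := rho * cos theta; pose y0 := rho * sin theta.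
pose F := nbhs (x0, y0).
have FF : ProperFilter F by exact: nbhs_pfilter.
have xy2 : x0 ^+ 2 + y0 ^+ 2 = rho ^+ 2.
  by rewrite /x0 /y0 !exprMn -mulrDr cos2Dsin2 mulr1.
(* a + i b is the quotient of the point p by rho e^(i theta). It is near 1, so [atan (b p / a p)] is
   a continuous branch of its argument. *)
pose a (p : R * R) := (p.1 * x0 + p.2 * y0) / rho ^+ 2.
pose b (p : R * R) := (p.2 * x0 - p.1 * y0) / rho ^+ 2.
pose r p := rho * Num.sqrt (a p ^+ 2 + b p ^+ 2).
pose t p := theta + atan (b p / a p).
have rn : rho ^+ 2 != 0 by rewrite expf_neq0 // gt_eqF.
have c1 : p.1 @[p --> F] --> x0 by exact: cvg_fst.
have c2 : p.2 @[p --> F] --> y0 by exact: cvg_snd.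
have ca : a p @[p --> F] --> (1 : R).
  have -> : 1 = (x0 * x0 + y0 * y0) / rho ^+ 2 :> R by rewrite -!expr2 xy2 divff.
  by apply: cvgMl; apply: cvgD; apply: cvgMl.
have cb : b p @[p --> F] --> (0 : R).
  have -> : 0 = (y0 * x0 - x0 * y0) / rho ^+ 2 :> R by rewrite [y0 * x0]mulrC subrr mul0r.
  by apply: cvgMl; apply: cvgB; apply: cvgMl.
have cr : r p @[p --> F] --> rho.
  have -> : rho = rho * Num.sqrt (1 ^+ 2 + 0 ^+ 2).
    by rewrite expr1n expr0n addr0 sqrtr1 mulr1.
  apply: cvgMr; apply: continuous_cvg; first exact: sqrt_continuous.
  by apply: cvgD; rewrite ?expr2; apply: cvgM.
have ct : t p @[p --> F] --> theta.
  have -> : theta = theta + atan (0 / 1) by rewrite mul0r atan0 addr0.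
  apply: cvgD; first exact: cvg_cst.
  apply: continuous_cvg; first exact: continuous_atan.
  by apply: cvgM => //; apply: cvgV.
have cphi : phi (t p) @[p --> F] --> phi theta.
  by apply: cvgB; [exact: cvgMr|exact: cvg_cst].
have ckappa : kappa (t p) @[p --> F] --> kappa theta.
  by apply: cvgMl; apply: cvgB; [exact: cvg_cst|exact: cvgMr].
have csin (f : R * R -> R) (l : R) : f p @[p --> F] --> l -> sin (f p) @[p --> F] --> sin l.
  by move=> fl; apply: continuous_cvg fl; exact: continuous_sin.
have cexp (f : R * R -> R) (l : R) k : f p @[p --> F] --> l -> f p ^+ k @[p --> F] --> l ^+ k.
  by move=> fl; exact: (continuous_cvg _ (@exprn_continuous R k l) fl).
have cs : (sin (phi (t p) + kappa (t p)) - r p ^+ Q * sin (kappa (t p))) ^+ D -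
    r p ^+ (Q * D - z) * sin (phi (t p)) ^+ D @[p --> F] -->
    (sin (phi theta + kappa theta) - rho ^+ Q * sin (kappa theta)) ^+ D -
    rho ^+ (Q * D - z) * sin (phi theta) ^+ D.
  apply: cvgB; last by apply: cvgM; [exact: cexp|exact: cexp (csin _ _ cphi)].
  apply: (cexp (fun p => sin (phi (t p) + kappa (t p)) - r p ^+ Q * sin (kappa (t p)))).
  apply: cvgB; last by apply: cvgM; [exact: cexp|exact: csin].
  by apply: (csin (fun p => phi (t p) + kappa (t p))); exact: cvgD.
have c3 : phi (t p) + 2 * kappa (t p) @[p --> F] --> phi theta + 2 * kappa theta.
  by apply: cvgD => //; exact: cvgMr.
have : \forall p \near F, Theta (Q * D) (p.1 +i* p.2)%C.
  near=> p.
  have ap : 0 < a p by near: p; exact: (cvgr_gt _ ca _ ltr01).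
  have rp : 0 < r p by near: p; exact: (cvgr_gt _ cr _ r0).
  have rp1 : r p < 1 by near: p; exact: (cvgr_lt _ cr _ r1).
  have -> : (p.1 +i* p.2)%C = (r p)%:C%C * cis (t p).
    rewrite /r /t; set c := b p / a p.
    have ab : Num.sqrt (a p ^+ 2 + b p ^+ 2) = a p * Num.sqrt (1 + c ^+ 2).
      rewrite -{2}[a p]gtr0_norm // -sqrtr_sqr -sqrtrM ?sqr_ge0 //; congr Num.sqrt.
      by rewrite /c; field; rewrite gt_eqF.
    have cc : 0 < 1 + c ^+ 2 by rewrite ltr_wpDr ?sqr_ge0.
    have cosE : Num.sqrt (1 + c ^+ 2) * cos (atan c) = 1.
      by rewrite cos_atan divff // gt_eqF // sqrtr_gt0.
    have sinE : Num.sqrt (1 + c ^+ 2) * sin (atan c) = c.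
      have cn : cos (atan c) != 0.
        by apply/eqP => c0; move/eqP: cosE; rewrite c0 mulr0 eq_sym oner_eq0.
      have -> : sin (atan c) = c * cos (atan c).
        by rewrite -{2}(atanK c) /tan divfK.
      by rewrite mulrCA cosE mulr1.
    have acb : a p * c = b p by rewrite /c mulrC divfK // gt_eqF.
    move: cosE sinE; rewrite ab; set q := Num.sqrt (1 + c ^+ 2) => cosE sinE.
    rewrite /cis mul_real_complex cosD sinD.
    have -> : rho * (a p * q) * (cos theta * cos (atan c) - sin theta * sin (atan c)) =
        x0 * a p * (q * cos (atan c)) - y0 * a p * (q * sin (atan c)).
      by rewrite /x0 /y0; ring.
    have -> : rho * (a p * q) * (sin theta * cos (atan c) + cos theta * sin (atan c)) =
        y0 * a p * (q * cos (atan c)) + x0 * a p * (q * sin (atan c)).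
      by rewrite /x0 /y0; ring.
    rewrite cosE sinE !mulr1.
    have -> : y0 * a p * c = y0 * b p by rewrite -acb; ring.
    have -> : x0 * a p * c = x0 * b p by rewrite -acb; ring.
    rewrite /a /b -xy2; apply/eqP; rewrite eq_complex /=.
    by apply/andP; split; apply/eqP; field; rewrite xy2.
  apply: Theta_polar; first by rewrite rp ltW.
  - by near: p; exact: (cvgr_gt _ cphi _ p0).
  - by near: p; exact: (cvgr_gt _ ckappa _ k0).
  - by near: p; exact: (cvgr_lt _ c3 _ pk).
  - rewrite -subr_gt0; near: p; apply: (cvgr_gt _ cs); by rewrite subr_gt0.
move=> /nbhs_ballP[e /= e0 eF]; exists e => // x y xe ye.
by apply: (eF (x, y)); split.
Unshelve. all: by end_near. Qed.

(** Choose u / v with u a - p v = 1 and n - a < v <= n. It exceeds p / a, so it cannot precede r /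
    b, and b = v K + a t with K = r a - p b >= 1 and t = u b - r v >= 0. A positive t would give b
    >= v + a > n; with t = 0, K divides both r and b, hence is 1. *)
Lemma Farey_pair_det (n a b p r : nat) :
  (0 < a <= n)%N -> (0 < b <= n)%N -> (n < a + b)%N ->
  coprime p a -> coprime r b -> Farey_pair n (p%:Q / a%:Q) (r%:Q / b%:Q) ->
  r%:Z * a%:Z - p%:Z * b%:Z = 1.
Proof.
move=> /andP[a0 an] /andP[b0 bn] abn cpa crb [Fx Fy xy Fbetween].
have [] := Bezoutz a%:Z p%:Z => u0 [v0 uv0].
have {}uv0 : u0 * a%:Z + v0 * p%:Z = 1.
  by rewrite uv0 /gcdz /= gcdnC (eqP cpa).
(* The Bezout solution is shifted by k so that v falls in the window (n - a, n]. *)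
pose k := ((n%:Z + v0) %/ a%:Z)%Z; pose v := k * a%:Z - v0; pose u := u0 + k * p%:Z.
have aZ : a%:Z != 0 by rewrite -lt0n.
have uv : u * a%:Z - p%:Z * v = 1 by rewrite -uv0 /u /v; ring.
have v_le : v <= n%:Z.
  by have := divz_eq (n%:Z + v0) a%:Z; have := modz_ge0 (n%:Z + v0) aZ; rewrite -/k /v; lia.
have v_gt : n%:Z - a%:Z < v.
  have := divz_eq (n%:Z + v0) a%:Z; have := ltz_mod (n%:Z + v0) aZ.
  by rewrite -/k /v; lia.
clearbody k; clearbody u v.
have v0' : 0 < v by lia.
have aq : (0 : rat) < a%:~R by rewrite ltr0z; lia.
have bq : (0 : rat) < b%:~R by rewrite ltr0z; lia.
have vq : (0 : rat) < v%:~R by rewrite ltr0z.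
have xw : p%:Q / a%:Q < u%:~R / v%:~R.
  rewrite ltr_pdivrMr // mulrAC ltr_pdivlMr // -!rmorphM ltr_int /=; lia.
have K1 : p%:Z * b%:Z < r%:Z * a%:Z.
  by move: xy; rewrite ltr_pdivrMr // mulrAC ltr_pdivlMr // -!rmorphM ltr_int.
have wy : r%:Z * v <= u * b%:Z.
  rewrite leNgt; apply/negP => h.
  have wy : u%:~R / v%:~R < r%:Q / b%:Q.
    by rewrite ltr_pdivrMr // mulrAC ltr_pdivlMr // -!rmorphM ltr_int.
  apply: (Fbetween (u%:~R / v%:~R)); last by rewrite xw wy.
  have [/andP[x0 _] _] := Fx; have [/andP[_ y1] _] := Fy.
  split; first by rewrite (le_trans x0 (ltW xw)) (le_trans (ltW wy) y1).
  have cuv : coprimez u v.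
    apply/coprimezP; exists (a%:Z, - p%:Z) => /=.
    by rewrite mulNr [a%:Z * u]mulrC.
  by rewrite coprimeq_den // gt_eqF //; lia.
have bE : b%:Z = v * (r%:Z * a%:Z - p%:Z * b%:Z) + a%:Z * (u * b%:Z - r%:Z * v).
  by rewrite -{1}[b%:Z]mulr1 -uv; ring.
move: bE; set K := r%:Z * a%:Z - p%:Z * b%:Z; set t := u * b%:Z - r%:Z * v => bE.
have K0 : 1 <= K by rewrite /K; lia.
have t0 : 0 <= t by rewrite /t; lia.
have tE : t = 0.
  apply/eqP; rewrite eq_le t0 andbT -ltzD1 add0r ltNge; apply/negP => t1.
  have : v <= v * K by rewrite ler_peMr // ltW.
  have : a%:Z <= a%:Z * t by rewrite ler_peMr.
  by move: bE v_gt bn; clear; lia.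
have bvK : b%:Z = v * K by rewrite bE tE mulr0 addr0.
have ruK : r%:Z = u * K.
  apply: (mulIf (lt0r_neq0 v0')); move: tE => /eqP; rewrite subr_eq0 => /eqP <-.
  by rewrite bvK; ring.
have : (`|K|%N %| gcdn r b)%N.
  rewrite dvdn_gcd; apply/andP; split.
    by rewrite -[r]/(`|r%:Z|%N) ruK abszM dvdn_mull.
  by rewrite -[b]/(`|b%:Z|%N) bvK abszM dvdn_mull.
rewrite (eqP crb) dvdn1 => /eqP; lia.
Qed.

(** * Interior points of Theta and the sum of the parts *)

Lemma Theta_conj (R : realType) (n : nat) (x y : R) :
  Theta n (x +i* y)%C -> Theta n (x +i* - y)%C.
Proof. by move=> [A stA /complex_eigenvalue_conj lA]; exists A. Qed.

Lemma interior_Theta (R : realType) (n : nat) (x y e : R) : 0 < e ->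
  (forall x' y' : R, `|x - x'| < e -> `|y - y'| < e -> Theta n (x' +i* y')%C) ->
  interior (@Theta R n : set R[i]^o) (x +i* y)%C.
Proof.
move=> e0 ball_e; apply/nbhs_ballP; exists e%:C%C => /=; first by rewrite ltcR.
move=> [x' y']; rewrite -ball_normE /= normc_def ltcR /= => lt_e.
have sq (s t : R) : `|s| <= Num.sqrt (s ^+ 2 + t ^+ 2).
  by rewrite -sqrtr_sqr ler_sqrt ?addr_ge0 ?sqr_ge0 // lerDl sqr_ge0.
by apply: ball_e; apply: le_lt_trans lt_e; [exact: sq|rewrite [X in Num.sqrt X]addrC; exact: sq].
Qed.

Lemma typeII_eigenvalue_interior (R : realType) (Q D z n : nat) (B : 'M[R]_n)
    (zs : seq nat) (P P' : int) (rho theta : R) :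
  (0 < D)%N -> (4 <= Q)%N -> (2 * z < Q)%N ->
  typeII_form Q D B zs -> sumn zs <> z ->
  P' * Q%:Z - P * (Q * D - z)%N%:Z = 1 ->
  0 < rho -> (2 * pi) * P%:~R < Q%:R * theta ->
  (Q * D - z)%:R * theta < (2 * pi) * P'%:~R ->
  complex_eigenvalue B (rho%:C%C * cis theta) ->
  exists2 e : R, 0 < e & forall x y : R,
    `|rho * cos theta - x| < e -> `|rho * sin theta - y| < e ->
    Theta (Q * D) (x +i* y)%C.
Proof.
move=> D0 Q4 zQ zB Zz det rho0 tP tP' lB.
have Q0 : (0 < Q)%N by exact: leq_trans Q4.
have QDQ : (Q <= Q * D)%N by rewrite leq_pmulr.
have m03 : (3 <= Q * D - z)%N by lia.
have ZQ : (sumn zs < Q)%N by case: zB => _ _ h _; lia.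
have zltQ : (z < Q)%N by lia.
have pi0 := pi_gt0 R; have DR : 0 < D%:R :> R by rewrite ltr0n.
pose phi := Q%:R * theta - (2 * pi) * P%:~R.
pose kappa := ((2 * pi) * P'%:~R - (Q * D - z)%:R * theta) / D%:R.
have p0 : 0 < phi by rewrite subr_gt0.
have k0 : 0 < kappa by rewrite divr_gt0 // subr_gt0.
have detR : P'%:~R * Q%:R - P%:~R * (Q * D - z)%:R = 1 :> R.
  by have := congr1 (fun t : int => t%:~R : R) det; rewrite rmorphB !rmorphM.
have sumE : (Q * D - z)%:R * phi + (Q * D)%:R * kappa = 2 * pi.
  have -> : 2 * pi = 2 * pi * (P'%:~R * Q%:R - P%:~R * (Q * D - z)%:R) :> R by rewrite detR mulr1.
  by rewrite natrM /phi /kappa; field; rewrite gt_eqF.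
have m03R : 3 <= (Q * D - z)%:R :> R by rewrite (ler_nat _ 3).
have QD4R : 4 <= (Q * D)%:R :> R by rewrite (ler_nat _ 4) (leq_trans Q4).
have bound : 3 * phi + 4 * kappa <= 2 * pi by rewrite -sumE; nra.
have sp : 0 < sin phi by apply: sin_gt0_pi; rewrite p0; lra.
have l0 : rho%:C%C * cis theta != 0.
  by rewrite mulf_neq0 ?cis_neq0 // fmorph_eq0 gt_eqF.
have lQ : (rho%:C%C * cis theta) ^+ Q = (rho ^+ Q)%:C%C * cis phi.
  by rewrite exprMn cisX -real_complexX /phi cisD -mulrN -rmorphN cis_2piz mulr1.
(* As 0 < phi < pi, the Q-th power is not real. *)
have lQ' (a : R) : 0 < a -> (rho%:C%C * cis theta) ^+ Q != a%:C%C.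
  move=> a0; rewrite lQ /cis mul_real_complex; apply/eqP => /(congr1 (@complex.Im R)) /= /eqP.
  by rewrite mulf_eq0 !gt_eqF ?exprn_gt0.
have [a [a01 prodE]] := typeII_eigenvalue_prod Q0 D0 zB lB l0 lQ'.
have [rho1 slack] := root_slack D0 Q4 m03 zQ ZQ det rho0 tP tP' a01 prodE Zz.
apply: (@Theta_near_slack R Q D z P P') => //; first by rewrite rho0.
rewrite -/phi -/kappa; lra.
Qed.

(** A sum other than z would make the eigenvalue interior to Theta, while the arc lies on the
    boundary. What remains is to bring both intervals of arguments and both orders of Q and Q D - z
    into the sector of [typeII_eigenvalue_interior]. *)
Lemma Karpelevic_mx_typeII_sum (R : realType) (Q D z n : nat)
    (B : 'M[R]_n) (zs : seq nat) :
  n = (Q * D)%N -> (0 < D)%N -> (4 <= Q)%N -> (2 * z < Q)%N ->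
  Karpelevic_mx Q (Q * D - z) B -> typeII_form Q D B zs -> sumn zs = z.
Proof.
move=> nE0; subst n => D0 Q4 zQ [_ [lambda lB [[_ notint] [p [r [cpa crb Fpr [theta [l0 lE] arc]]]]]]] zB.
apply: contrapT => Zz; apply: notint.
have QDQ : (0 < Q <= Q * D)%N by rewrite leq_pmulr // (leq_trans _ Q4).
have zlt : (z < Q)%N by move: zQ; clear; lia.
have m0n : (0 < Q * D - z <= Q * D)%N.
  by rewrite leq_subr subn_gt0 andbT; case/andP: QDQ => _; exact: leq_trans.
have nlt : (Q * D < Q + (Q * D - z))%N.
  by move: QDQ zlt; clear; move: (Q * D)%N => n; lia.
pose rho := Num.sqrt (complex.Re lambda ^+ 2 + complex.Im lambda ^+ 2).
have nE : `|lambda| = rho%:C%C by rewrite normc_def.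
have rho0 : 0 < rho by rewrite -ltcR -nE normr_gt0.
rewrite nE in lE.
have lE' : lambda = (rho * cos theta +i* (rho * sin theta))%C.
  by rewrite {1}lE -mul_real_complex.
have lBc : complex_eigenvalue B (rho%:C%C * cis (- theta)).
  have -> : rho%:C%C * cis (- theta) = conjc lambda.
    by rewrite lE' /cis mul_real_complex cosN sinN mulrN.
  exact: complex_eigenvalue_conj.
have lB' : complex_eigenvalue B (rho%:C%C * cis theta) by rewrite /cis -lE.
suff [e e0 He] : exists2 e : R, 0 < e & forall x y : R,
    `|rho * cos theta - x| < e -> `|rho * sin theta - y| < e ->
    Theta (Q * D) (x +i* y)%C.
  by rewrite lE'; exact: interior_Theta He.
have conj_case (P P' : int) : P' * Q%:Z - P * (Q * D - z)%N%:Z = 1 ->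
    (2 * pi) * P%:~R < Q%:R * (- theta) ->
    (Q * D - z)%:R * (- theta) < (2 * pi) * P'%:~R ->
    exists2 e : R, 0 < e & forall x y : R,
      `|rho * cos theta - x| < e -> `|rho * sin theta - y| < e ->
      Theta (Q * D) (x +i* y)%C.
  move=> det tP tP'.
  have [e e0 He] := typeII_eigenvalue_interior D0 Q4 zQ zB Zz det rho0 tP tP' lBc.
  exists e => // x y xe ye; rewrite -[y]opprK; apply: Theta_conj; apply: He.
    by rewrite cosN.
  by rewrite sinN mulrN opprK -normrN opprD !opprK.
have direct_case (P P' : int) : P' * Q%:Z - P * (Q * D - z)%N%:Z = 1 ->
    (2 * pi) * P%:~R < Q%:R * theta ->
    (Q * D - z)%:R * theta < (2 * pi) * P'%:~R ->
    exists2 e : R, 0 < e & forall x y : R,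
      `|rho * cos theta - x| < e -> `|rho * sin theta - y| < e ->
      Theta (Q * D) (x +i* y)%C.
  move=> det tP tP'.
  exact: typeII_eigenvalue_interior zB Zz det rho0 tP tP' lB'.
have m0R : 0 < (Q * D - z)%:R :> R by rewrite ltr0n; case/andP: m0n.
have QR : 0 < Q%:R :> R by rewrite ltr0n (leq_trans _ Q4).
(* In that sector the fraction with denominator Q is the left end. The first interval has this form
   if Q <= Q D - z, and the second after conjugation; in the other order the two intervals exchange
   roles. *)
have [le|gt] := leqP Q (Q * D - z); [rewrite (minn_idPl le) (maxn_idPr le) in cpa crb Fpr arc |
  rewrite (minn_idPr (ltnW gt)) (maxn_idPl (ltnW gt)) in cpa crb Fpr arc].
  have det : r%:Z * Q%:Z - p%:Z * (Q * D - z)%N%:Z = 1.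
    exact: Farey_pair_det QDQ m0n nlt cpa crb Fpr.
  case: arc => /andP[]; rewrite ltr_pdivrMr // ltr_pdivlMr // => h1 h2.
    by apply: (direct_case p%:Z r%:Z) => //; rewrite [_ * theta]mulrC.
  apply: (conj_case (p%:Z - Q%:Z) (r%:Z - (Q * D - z)%N%:Z)).
  - by rewrite -det; ring.
  - by rewrite rmorphB /=; lra.
  - by rewrite rmorphB /=; lra.
have det : r%:Z * (Q * D - z)%N%:Z - p%:Z * Q%:Z = 1.
  by rewrite addnC in nlt; exact: Farey_pair_det m0n QDQ nlt cpa crb Fpr.
case: arc => /andP[]; rewrite ltr_pdivrMr // ltr_pdivlMr // => h1 h2.
  apply: (conj_case (- r%:Z) (- p%:Z)).
  - by rewrite -det; ring.
  - by rewrite rmorphN /=; lra.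
  - by rewrite rmorphN /=; lra.
apply: (direct_case (Q%:Z - r%:Z) ((Q * D - z)%N%:Z - p%:Z)).
- by rewrite -det; ring.
- by rewrite rmorphB /=; lra.
- by rewrite rmorphB /=; lra.
Qed.

Theorem theorem5p6 (R : realType) (q c d z n : nat)
    (hq : (2 <= q)%N) (hc : (1 <= c)%N) (hd : (1 <= d)%N)
    (hz : (1 <= z <= q - 1)%N) (hcop : coprime (c * q) z)
    (hn : n = (c * d * q)%N)
    (B : 'M[R]_n)
    (hB : Karpelevic_mx_min (c * q) (c * d * q - z) B)
    (zhat : seq nat)
    (hzhat : partition_class_II (c * q) d B zhat) :
  (exists s : seq nat, typeII_form q (c * d) (B ^+ c) s) /\
  consists_of_parts
    [set map Posz s | s in partition_class_II q (c * d) (B ^+ c)]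
    (part_indices c d) (z_part c zhat) (next_part c d zhat).
Proof.
have q0 : (0 < q)%N by exact: ltnW.
have Q0 : (0 < c * q)%N by rewrite muln_gt0 hc.
have zB : typeII_form (c * q) d B zhat.
  by case: hzhat => z0 z0B [k _ <-]; exact: typeII_form_rot.
have szd : size zhat = d by case: zB.
have [zq cop] : (sumn zhat <= q - 1)%N /\ coprime c (sumn zhat).
  (* For c = 1 the bound is part of the type II form and coprimality is automatic; for c >= 2 both
     follow once the sum is known to be z. *)
  have [c2|c1] := leqP 2 c; last first.
    have cE : c = 1%N by apply/eqP; rewrite eqn_leq hc -ltnS c1.
    by rewrite cE coprime1n; case: zB => _ _; rewrite cE mul1n.
  have -> : sumn zhat = z.
    have [BK _] := hB; rewrite mulnAC in BK; rewrite mulnAC in hn.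
    (* This supplies the size conditions c q >= 4 and 2 z < 2 q <= c q. *)
    have Q2 : (2 * q <= c * q)%N by rewrite leq_mul2r c2 orbT.
    apply: Karpelevic_mx_typeII_sum hn hd _ _ BK zB.
      by move: hq Q2; clear; lia.
    by move: hz Q2; clear; lia.
  by move: hcop; rewrite coprimeMl => /andP[-> _]; case/andP: hz.
rewrite -szd in hd zB *; split; last exact: consists_of_power_parts.
by exists (power_parts c zhat); exact: typeII_form_power.
Qed.
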